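(* Consider a sequence of multi-indices $\bm n=(n_1,\dots,n_r)\in\mathbb N^r$ with $|\bm n|\to\infty$ and parameters $\bm\alpha_{\bm n}=(\alpha_1^{(\bm n)},\dots,\alpha_r^{(\bm n)})$ with $\alpha_i^{(\bm n)}>-1$, $\alpha_i^{(\bm n)}-\alpha_j^{(\bm n)}\notin\mathbb Z$ for $i\neq j$, such that $$\lim_{|\bm n|\to\infty}\frac{\alpha_i^{(\bm n)}}{|\bm n|}=A_i\ge0,\qquad \lim_{|\bm n|\to\infty}\frac{n_i}{|\bm n|}=\theta_i>0,\qquad i=1,\dots,r.$$ Then the function $y=u\,\mathcal G_\mu(u)$, where $\mathcal G_\mu$ is the Cauchy transform of any limiting zero distribution $\mu$ of the rescaled Type II multiple Laguerre polynomials of the first kind $L^{(\bm\alpha_{\bm n})}_{\bm n}(|\bm n|\,x)$, satisfies the algebraic equation $$u\prod_{i=1}^r\left(y+A_i+\theta_i-u\right)=(u-y)\prod_{i=1}^r\left(y+A_i-u\right).$$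
   Context: $\mathbb N=\{1,2,\dots\}$, $|\bm n|=n_1+\dots+n_r$. Type II multiple Laguerre polynomial of the first kind $L^{(\bm\alpha)}_{\bm n}$: the monic polynomial of degree $|\bm n|$ with $\int_0^\infty L^{(\bm\alpha)}_{\bm n}(x)x^{\alpha_j+k}e^{-x}dx=0$ for $k=0,1,\dots,n_j-1$, $j=1,\dots,r$. For a polynomial $p$ of degree $N$ with zeros $\lambda_1,\dots,\lambda_N$ (with multiplicity), the normalized zero-counting measure is $\chi(p)=\frac1N\sum_j\delta_{\lambda_j}$; a limiting zero distribution is a weak-* limit of these measures along a subsequence. Cauchy transform: $\mathcal G_\mu(u)=\int\frac{d\mu(v)}{u-v}$; the equation is understood in a neighborhood of $u=\infty$. *)

(* Defs.v *)
From HB Require Import structures.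
From mathcomp Require Import all_boot all_order all_algebra.
From mathcomp Require Import complex.
From mathcomp Require Import all_classical all_reals all_analysis.

Set Implicit Arguments.
Unset Strict Implicit.
Unset Printing Implicit Defensive.

Import Order.TTheory GRing.Theory Num.Theory.
Import numFieldNormedType.Exports.

Local Open Scope classical_set_scope.
Local Open Scope ring_scope.
Local Open Scope complex_scope.

Definition mi_size (r : nat) (n : 'I_r -> nat) : nat := (\sum_(i < r) n i)%N.

Definition is_multLaguerre1 (R : realType) (r : nat) (alpha : 'I_r -> R)
    (n : 'I_r -> nat) (p : {poly R}) : Prop :=
  [/\ p \is monic, size p = (mi_size n).+1
    & forall (j : 'I_r) (k : nat), (k < n j)%N ->
      (\int[lebesgue_measure]_(x in `]0%R, +oo[)
         (p.[x] * x `^ (alpha j + k%:R) * expR (- x))%:E)%E = 0%E].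

(* The complex plane with its Borel sigma-algebra. *)
Definition complexB (R : realType) := g_sigma_algebraType (@open R[i]^o).

(* The complex zeros, repeated with multiplicity, in some order. *)
Definition zeros (R : realType) (p : {poly R}) : seq R[i] :=
  sval (closed_field_poly_normal (map_poly (real_complex R) p)).

Section ZeroCounting.
Context (R : realType) (p : {poly R}).

Definition zero_counting_measure :=
  mscale ((size (zeros p))%:R^-1%:nng : {nonneg R})
    (msum (fun k => \d_((zeros p)`_k : complexB R)) (size (zeros p))).

HB.instance Definition _ := Measure.on zero_counting_measure.

End ZeroCounting.

(* Weak-* convergence in the dual of C_0(C); for sequences of bounded mass it
   is enough to test on continuous functions with compact support. *)
Definition weak_star_cvg (R : realType)
    (mu_ : nat -> {measure set (complexB R) -> \bar R})
    (mu : {measure set (complexB R) -> \bar R}) : Prop :=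
  forall f : R[i]^o -> R, continuous f -> compact (closure [set z | f z != 0]) ->
    (fun m => \int[mu_ m]_z f z) @ \oo --> \int[mu]_z f z.

Definition limiting_zero_distribution (R : realType) (p : nat -> {poly R})
    (mu : {measure set (complexB R) -> \bar R}) : Prop :=
  exists phi : nat -> nat, {homo phi : a b / (a < b)%N} /\
    weak_star_cvg (fun m => zero_counting_measure (p (phi m))) mu.

Definition cauchy_transform (R : realType)
    (mu : {measure set (complexB R) -> \bar R}) (u : R[i]) : R[i] :=
  (\int[mu]_v complex.Re (u - (v : R[i]))^-1) +i*
  (\int[mu]_v complex.Im (u - (v : R[i]))^-1).

(* Main.v *)
(* The Mellin transform of [p(x) e^{-x}] is [Gamma (s + 1) Q(s)] with [Q] a polynomial, and
   orthogonality prescribes all the zeros of [Q]. The relation between [Q(s + 1)] and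
   [Q(s)] then becomes a linear differential equation of order [r + 1] for the
   multiple Laguerre polynomial, and each linear factor of [Q] becomes one step
   [p |-> (x - c) p - x p'], [c > 0], of a recursion starting from [1].
   Such a step preserves the property that all the zeros are positive, and a barrier
   argument on the logarithmic derivative shows that it moves an upper bound for
   the zeros by at most a constant; hence the rescaled zeros stay bounded.
   Away from the zeros, [P^(l)(u) / (N^l P(u))] differs from
   [(P'(u) / (N P(u)))^l] by [O(1/N)], so that dividing the rescaled differential
   equation by [P(u)] gives the algebraic equation in the limit. *)

From HB Require Import structures.
Require Import Defs.
From mathcomp Require Import all_boot all_order all_algebra.
From mathcomp Require Import complex ring lra zify.
From mathcomp Require Import all_classical all_reals all_analysis.
From mathcomp Require Import measurable_realfun.

Set Implicit Arguments.
Unset Strict Implicit.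
Unset Printing Implicit Defensive.

Import Order.TTheory GRing.Theory Num.Theory.
Import numFieldNormedType.Exports.

Local Open Scope classical_set_scope.
Local Open Scope ring_scope.
Local Open Scope complex_scope.

(** * The polynomial part of the Mellin transform, and the differential equation *)

(** The test functions of weak-* convergence have compact support, whereas v |-> 1/(u - v) does not
    and has a pole at u. A bound on the rescaled zeros that is uniform along the sequence is
    therefore what gives access to the Cauchy transform. Since N = |n| steps are composed, each of
    them may cost only O(1) before rescaling. An upper bound for the zeros does not propagate that
    well by itself, because the displacement depends on how the zeros accumulate below the bound;
    carrying along the logarithmic derivative at the barrier controls this. The order r + 1 comes
    from the quotient Q(s + 1)/Q(s): each block of n_i consecutive zeros telescopes to a quotient of
    two linear factors in s, so that n_i survives only as a coefficient, and Gamma(s + 2)/Gamma(s +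
    1) = s + 1 contributes one more factor. On the side of Q everything is a polynomial identity
    pulled back through the injectivity of [mellin]; analysis enters there only to turn the
    orthogonality integrals into values of Q. *)

Definition rising (R : comNzRingType) (k : nat) : {poly R} :=
  \prod_(l < k) ('X + l.+1%:R%:P).

Lemma risingS (R : comNzRingType) k :
  rising R k.+1 = rising R k * ('X + k.+1%:R%:P).
Proof. by rewrite /rising big_ord_recr. Qed.

(** At s, [rising k] is Gamma(s + k + 1)/Gamma(s + 1). Splitting off the first factor instead of the
    last one exposes the shift s |-> s + 1. *)
Lemma risingSl (R : comNzRingType) k :
  rising R k.+1 = ('X + 1) * (rising R k \Po ('X + 1)).
Proof.
rewrite /rising big_ord_recl /= rmorph_prod /=; congr (_ * _).
apply: eq_bigr => i _.
by rewrite comp_polyD comp_polyX comp_polyC /bump add1n -addrA -polyCD -natr1 [_ + 1]addrC.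
Qed.

Lemma rising_monic (R : comNzRingType) k : rising R k \is monic.
Proof. by apply: monic_prod => i _; rewrite monicXaddC. Qed.

Lemma size_rising (R : comNzRingType) k : size (rising R k) = k.+1.
Proof.
elim: k => [|k IH]; first by rewrite /rising big_ord0 size_poly1.
by rewrite risingS size_Mmonic ?monicXaddC// ?monic_neq0 ?rising_monic// IH size_XaddC addn2.
Qed.

(* [mellin h] is the polynomial [Q] with
   [\int_0^oo h(x) x^s e^{-x} dx = Gamma (s + 1) * Q(s)]. *)
HB.lock Definition mellin (R : comNzRingType) (h : {poly R}) : {poly R} :=
  \sum_(k < size h) h`_k *: rising R k.

Lemma mellinE (R : comNzRingType) n (h : {poly R}) : (size h <= n)%N ->
  mellin h = \sum_(k < n) h`_k *: rising R k.
Proof.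
move=> hn; rewrite mellin.unlock (big_ord_widen n (fun k => h`_k *: rising R k)) //.
rewrite big_mkcond; apply: eq_bigr => i _; case: ltnP => // hi.
by rewrite nth_default// scale0r.
Qed.

Lemma mellin_is_linear (R : comNzRingType) : linear (@mellin R).
Proof.
move=> a g h; set n := maxn (size g) (size h).
rewrite (@mellinE _ n); last first.
  rewrite (leq_trans (size_polyD _ _))// geq_max leq_maxr andbT.
  by rewrite (leq_trans (size_scale_leq _ _)) ?leq_maxl.
rewrite (@mellinE _ n g) ?leq_maxl// (@mellinE _ n h) ?leq_maxr//.
rewrite scaler_sumr -big_split; apply: eq_bigr => i _ /=.
by rewrite coefD coefZ scalerDl scalerA.
Qed.

HB.instance Definition _ (R : comNzRingType) :=
  GRing.isLinear.Build R {poly R} {poly R} _ (@mellin R) (@mellin_is_linear R).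


Lemma mellinXn (R : comNzRingType) k : mellin ('X^k : {poly R}) = rising R k.
Proof.
rewrite (@mellinE _ k.+1) ?size_polyXn// big_ord_recr /= coefXn eqxx scale1r.
by rewrite big1 ?add0r// => i _; rewrite coefXn ltn_eqF// scale0r.
Qed.

Lemma mellin1 (R : comNzRingType) : mellin (1 : {poly R}) = 1.
Proof. by rewrite -(expr0 'X) mellinXn /rising big_ord0. Qed.

(** Multiplication by x replaces s by s + 1 under the integral, and Gamma(s + 2) = (s + 1) Gamma(s +
    1) gives the extra factor. *)
Lemma mellin_mulX (R : comNzRingType) (h : {poly R}) :
  mellin ('X * h) = ('X + 1) * (mellin h \Po ('X + 1)).
Proof.
rewrite -[h]coefK poly_def mulr_sumr !linear_sum /= mulr_sumr.
apply: eq_bigr => i _; rewrite -scalerAr !linearZ /= -scalerAr; congr (_ *: _).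
by rewrite -exprS !mellinXn risingSl.
Qed.

(** Integration by parts of (h e^(-x))' = (h' - h) e^(-x) against x^(s + 1), in algebraic form and
    checked on monomials. *)
Lemma mellin_deriv (R : comNzRingType) (h : {poly R}) :
  mellin ('X * h^`()) - mellin ('X * h) = - ('X + 1) * mellin h.
Proof.
rewrite -[h]coefK poly_def !(linear_sum, mulr_sumr) /=.
rewrite -big_split /=.
apply: eq_bigr => i _; rewrite !linearZ /= -!scalerAr !linearZ /= -scalerDr.
congr (_ *: _); rewrite -exprS derivXn !mellinXn risingS.
have -> : 'X * ('X^(i.-1) *+ i) = 'X^i *+ i :> {poly R}.
  by case: (i : nat) => [|k]; rewrite ?mulr0n ?mulr0// mulrnAr -exprS.
rewrite raddfMn /= mellinXn -natr1 polyCD polyC_natr; ring.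
Qed.

(** The transform is triangular with unit diagonal, each [rising k] being monic of degree k. Hence
    degree and leading coefficient survive, and injectivity follows. *)
Lemma mellin_lead (R : comNzRingType) (h : {poly R}) : exists2 g : {poly R},
  mellin h = lead_coef h *: rising R (size h).-1 + g & (size g <= (size h).-1)%N.
Proof.
exists (\sum_(k < (size h).-1) h`_k *: rising R k).
  have [->|h0] := eqVneq h 0.
    by rewrite linear0 lead_coef0 scale0r size_poly0 big_ord0 addr0.
  rewrite (@mellinE _ (size h).-1.+1) ?leqSpred//.
  by rewrite big_ord_recr /= addrC -lead_coefE.
rewrite (leq_trans (size_sum _ _ _))//; apply/bigmax_leqP => i _.
by rewrite (leq_trans (size_scale_leq _ _))// size_rising.
Qed.

Lemma coef_mellin (R : comNzRingType) (h : {poly R}) :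
  (mellin h)`_(size h).-1 = lead_coef h.
Proof.
have [g -> sg] := mellin_lead h; rewrite coefD (nth_default _ sg) addr0 coefZ.
have /monicP := rising_monic R (size h).-1.
by rewrite lead_coefE size_rising /= => ->; rewrite mulr1.
Qed.

Lemma mellin_eq0 (R : comNzRingType) (h : {poly R}) : mellin h = 0 -> h = 0.
Proof.
by move=> h0; apply/eqP; rewrite -lead_coef_eq0 -coef_mellin h0 coef0.
Qed.

Lemma mellin_inj (R : comNzRingType) : injective (@mellin R).
Proof.
move=> g h gh; apply/eqP; rewrite -subr_eq0; apply/eqP/mellin_eq0.
by rewrite linearB /= gh subrr.
Qed.

Lemma mellin_monic (R : comNzRingType) (h : {poly R}) : h \is monic ->
  mellin h \is monic /\ size (mellin h) = size h.
Proof.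
move=> hm; have hn0 : (0 < size h)%N by rewrite size_poly_gt0 monic_neq0.
have [g -> sg] := mellin_lead h; rewrite (monicP hm) scale1r.
have lt : (size g < size (rising R (size h).-1))%N by rewrite size_rising ltnS.
rewrite monicE lead_coefDl// size_polyDl// size_rising prednK//; split=> //.
exact: rising_monic.
Qed.

Definition laguerre_step (R : comNzRingType) (q : R) (h : {poly R}) : {poly R} :=
  ('X - (1 + q)%:P) * h - 'X * h^`().

Lemma mellin_step (R : comNzRingType) q (h : {poly R}) :
  mellin (laguerre_step q h) = ('X - q%:P) * mellin h.
Proof.
rewrite /laguerre_step mulrBl !linearB /= mul_polyC linearZ /=.
rewrite -[_ - _ - _]addrA -opprD addrC.
have -> : - ((1 + q) *: mellin h + mellin ('X * h^`())) + mellin ('X * h) =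
  - (mellin ('X * h^`()) - mellin ('X * h)) - (1 + q) *: mellin h by ring.
by rewrite mellin_deriv -mul_polyC polyCD; ring.
Qed.

Lemma mellin_foldr_step (R : comNzRingType) (qs : seq R) :
  mellin (foldr (@laguerre_step R) 1 qs) = \prod_(q <- qs) ('X - q%:P).
Proof.
elim: qs => [|q qs IH]; first by rewrite big_nil /= mellin1.
by rewrite big_cons /= mellin_step IH.
Qed.

(** For e = 1 this is x d/dx + c conjugated by e^(-x). The parameter [e] is there for the rescaling,
    where it becomes 1/N. *)
Definition eulerop (R : comNzRingType) (e c : R) (h : {poly R}) : {poly R} :=
  e *: ('X * h^`()) - 'X * h + c *: h.

Lemma mellin_foldr_eulerop (R : comNzRingType) (cs : seq R) (h : {poly R}) :
  mellin (foldr (eulerop 1) h cs) =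
  \prod_(c <- cs) ((c - 1)%:P - 'X) * mellin h.
Proof.
elim: cs => [|c cs IH]; first by rewrite big_nil mul1r.
rewrite big_cons /= {1}/eulerop scale1r linearD linearB linearZ /= mellin_deriv IH.
by rewrite -mul_polyC polyCB; ring.
Qed.

(** The shift moves the zeros a, ..., a + n - 1 down by one, so all factors cancel except those at
    the two ends of the block. *)
Lemma prod_shift (R : comNzRingType) (a : R) (n : nat) :
  (a%:P - 'X + n%:R%:P - 1) * (\prod_(k < n) ('X - (a + k%:R)%:P) \Po ('X + 1)) =
  (a%:P - 1 - 'X) * \prod_(k < n) ('X - (a + k%:R)%:P).
Proof.
elim: n => [|n IH]; first by rewrite !big_ord0 comp_polyC; ring.
rewrite !big_ord_recr /= comp_polyM !comp_polyB comp_polyX !comp_polyC.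
set Q := _ \Po _ in IH *; set Q0 := \prod_(i < n) _ in IH *.
rewrite (_ : Q * _ = - (((a%:P - 'X + n%:R%:P - 1)) * Q)); last by rewrite polyCD; ring.
by rewrite IH -natr1 !polyCD; ring.
Qed.

(** On the Mellin side the leading ['X *] is the shift Q(s) |-> (s + 1) Q(s + 1), and [eulerop 1 0]
    supplies the matching factor -(s + 1). What remains is the telescoped quotient of each block. *)
Lemma laguerre_ode (R : idomainType) (I : eqType) (s : seq I) (a : I -> R)
    (n : I -> nat) (p : {poly R}) :
  mellin p = \prod_(i <- s) \prod_(k < n i) ('X - (a i + k%:R)%:P) ->
  'X * foldr (eulerop 1) p [seq 1 + a i + (n i)%:R | i <- s] +
  eulerop 1 0 (foldr (eulerop 1) p [seq a i | i <- s]) = 0.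
Proof.
move=> pE; apply: mellin_eq0; rewrite linearD /= mellin_mulX.
rewrite -[eulerop 1 0 _]/(foldr (eulerop 1) p (0 :: map a s)).
rewrite !mellin_foldr_eulerop big_cons !big_map pE comp_polyM !rmorph_prod /=.
suff -> : (\prod_(i <- s) ((((1 + a i + (n i)%:R) - 1)%:P - 'X) \Po ('X + 1))) *
   (\prod_(i <- s) ((\prod_(k < n i) ('X - (a i + k%:R)%:P)) \Po ('X + 1))) =
   (\prod_(i <- s) ((a i - 1)%:P - 'X)) *
   (\prod_(i <- s) (\prod_(k < n i) ('X - (a i + k%:R)%:P))).
  by rewrite sub0r polyCN; ring.
rewrite -!big_split; apply: eq_bigr => i _ /=.
rewrite comp_polyB comp_polyX comp_polyC.
rewrite -[(a i - 1)%:P]/(polyC _) (polyCB (a i)) -prod_shift; congr (_ * _).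
by rewrite !(polyCB, polyCD); ring.
Qed.

Lemma eulerop_comp (R : fieldType) (e c : R) (h : {poly R}) : e != 0 ->
  eulerop e (e * c) (h \Po (e^-1 *: 'X)) = e *: (eulerop 1 c h \Po (e^-1 *: 'X)).
Proof.
move=> e0; rewrite /eulerop deriv_comp scale1r comp_polyD comp_polyB !comp_polyM.
rewrite comp_polyX comp_polyZ derivZ derivX.
rewrite -!mul_polyC !polyCM.
have ee : e%:P * (e^-1)%:P = 1 by rewrite -polyCM divff.
set d := _^`() \Po _; set g := h \Po _.
ring: ee.
Qed.

Lemma foldr_eulerop_comp (R : fieldType) (e : R) (cs : seq R) (h : {poly R}) :
  e != 0 ->
  foldr (eulerop e) (h \Po (e^-1 *: 'X)) [seq e * c | c <- cs] =
  e ^+ size cs *: (foldr (eulerop 1) h cs \Po (e^-1 *: 'X)).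
Proof.
move=> e0; elim: cs => [|c cs IH]; first by rewrite expr0 scale1r.
rewrite /= IH exprSr -scalerA -eulerop_comp//.
by rewrite /eulerop linearZ /= -!scalerAr !scalerA ![_ * _ ^+ _]mulrC -!scalerA -scalerBr -scalerDr.
Qed.

Lemma laguerre_ode_rescaled (R : fieldType) (e : R) (I : eqType) (s : seq I)
    (a : I -> R) (n : I -> nat) (p : {poly R}) : e != 0 ->
  mellin p = \prod_(i <- s) \prod_(k < n i) ('X - (a i + k%:R)%:P) ->
  let P := p \Po (e^-1 *: 'X) in
  'X * foldr (eulerop e) P [seq e * (1 + a i + (n i)%:R) | i <- s] +
  eulerop e 0 (foldr (eulerop e) P [seq e * a i | i <- s]) = 0.
Proof.
(* Each operator indexed by [s] absorbs one factor [e]; the last one goes to ['X] in the first term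
   and to [eulerop e 0] in the second. *)
move=> e0 /laguerre_ode /(congr1 (fun h => e ^+ (size s).+1 *: (h \Po (e^-1 *: 'X)))).
rewrite comp_poly0 scaler0 comp_polyD comp_polyM comp_polyX scalerDr => /= <-.
rewrite [in RHS]exprS -[in RHS]scalerA; congr (_ + _).
  rewrite -[LHS]scale1r (map_comp ( *%R e)) foldr_eulerop_comp// size_map.
  rewrite -!scalerAr -!scalerAl !scalerA; congr (_ *: _).
  by rewrite mulrAC divff.
have := foldr_eulerop_comp (0 :: map a s) p e0.
by rewrite /= mulr0 size_map -map_comp exprS.
Qed.

(** * The integral of x^s e^(-x) over the positive half-line *)

Definition gamma_density (R : realType) (s x : R) : R := x `^ s * expR (- x).

Lemma gamma_density_ge0 (R : realType) (s x : R) : 0 <= gamma_density s x.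
Proof. by rewrite mulr_ge0 ?powR_ge0 ?expR_ge0. Qed.

Lemma measurable_gamma_density (R : realType) (s : R) (D : set R) :
  measurable_fun D (gamma_density s).
Proof.
apply: measurable_funS (@measurableT _ _) (@subsetT _ _) _ => //.
apply: measurable_funM; first exact: measurable_powR.
by apply: measurableT_comp => //; exact: measurable_funN.
Qed.

Lemma is_derive_gamma_density (R : realType) (s x : R) : 0 < x ->
  is_derive x 1 (gamma_density (s + 1)) ((s + 1) * gamma_density s x - gamma_density (s + 1) x).
Proof.
move=> x0; have dp := is_derive1_powR (s + 1) x0.
have de : is_derive x 1 (fun y : R => expR (- y)) (- expR (- x)).
  have H : is_derive (- x) 1 (@expR R) (expR (- x)) by exact: is_derive_expR.
  have := @is_derive1_comp _ (@expR R) (-%R) x _ _ H (is_deriveN _).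
  by move=> /(_ _ (is_derive_id x 1)); rewrite mulrN1.
have H : is_derive x 1 (gamma_density (s + 1)) _ := is_deriveM dp de.
by apply: is_derive_eq H _; rewrite addrK /gamma_density /GRing.scale /=; ring.
Qed.

Lemma continuous_gamma_density (R : realType) (s x : R) : 0 < x ->
  {for x, continuous (gamma_density s)}.
Proof.
move=> x0; rewrite -[s](subrK 1).
by apply/differentiable_continuous/derivable1_diffP; case: (is_derive_gamma_density (s - 1) x0).
Qed.

Lemma gamma_density_byparts (R : realType) (s a b : R) : 0 < a -> a < b ->
  ((s + 1)%:E * \int[lebesgue_measure]_(x in `[a, b]) (gamma_density s x)%:E =
  \int[lebesgue_measure]_(x in `[a, b]) (gamma_density (s + 1) x)%:E +
  (gamma_density (s + 1) b - gamma_density (s + 1) a)%:E)%E.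
Proof.
move=> a0 ab.
have cW t : {within `[a, b], continuous (gamma_density t)}.
  apply: continuous_in_subspaceT => x; rewrite inE/= in_itv/= => /andP[ax _].
  by apply: continuous_gamma_density; exact: lt_le_trans ax.
have ig t : lebesgue_measure.-integrable `[a, b] (EFin \o gamma_density t).
  by apply: continuous_compact_integrable => //; exact: segment_compact.
pose f x := (s + 1) * gamma_density s x - gamma_density (s + 1) x.
have := @continuous_FTC2 R f (gamma_density (s + 1)) a b ab.
have cf : {within `[a, b], continuous f}.
  move=> x; apply: cvgB; last exact: cW.
  by apply: cvgM; [exact: cvg_cst|exact: cW].
have b0 : 0 < b by exact: lt_trans ab.
have dF : derivable_oo_LRcontinuous (gamma_density (s + 1)) a b.
  split=> [x||].
  - rewrite in_itv/= => /andP[ax _].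
    by case: (is_derive_gamma_density s (lt_trans a0 ax)).
  - by apply/cvg_at_right_filter/continuous_gamma_density.
  - by apply/cvg_at_left_filter/continuous_gamma_density.
have F' : {in `]a, b[, (gamma_density (s + 1))^`()%classic =1 f}.
  move=> x; rewrite in_itv/= => /andP[ax _].
  by rewrite derive1E; case: (is_derive_gamma_density s (lt_trans a0 ax)).
move=> /(_ cf dF F') /=; rewrite -EFinB => <-.
rewrite -integralZl//; last exact: ig.
rewrite /f /=.
under [X in (_ = _ + X)%E]eq_integral do rewrite EFinB EFinM.
rewrite integralB_EFin//=; last exact: integrableZl (ig s).
have fi t : (\int[lebesgue_measure]_(x in `[a, b]) (gamma_density t x)%:E)%E \is a fin_num.
  exact: integrable_fin_num (ig t).
by rewrite addeCA subee ?adde0.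
Qed.

Lemma gamma_density_cvgy (R : realType) (s : R) :
  gamma_density s n.+2%:R @[n --> \oo] --> 0.
Proof.
have [k sk] : exists k : nat, s <= k%:R.
  by exists (Num.bound `|s|); rewrite (le_trans (ler_norm _))// ltW// archi_boundP.
(* From e^x >= x^(k + 1)/(k + 1)! one gets x^k e^(-x) <= (k + 1)!/x; at x = n + 2 this is at most (k
   + 1)!/(n + 1). *)
have c0 : (k.+1`!%:R * harmonic n : R) @[n --> \oo] --> 0.
  by rewrite -[X in _ --> X](mulr0 (k.+1`!%:R)); apply: cvgM; [exact: cvg_cst|exact: cvg_harmonic].
apply: squeeze_cvgr (cvg_cst 0) c0; apply: nearW => n; rewrite gamma_density_ge0 /=.
have x0 : 0 < n.+2%:R :> R by rewrite ltr0n.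
have x1 : 1 <= n.+2%:R :> R by rewrite ler1n.
have h1 : n.+2%:R `^ s <= n.+2%:R ^+ k :> R.
  by rewrite -(powR_mulrn _ (ltW x0)); exact: ler_powR.
rewrite /gamma_density expRN ler_pdivrMr ?expR_gt0//.
apply: (le_trans h1).
have h2 : n.+2%:R ^+ k.+1 <= k.+1`!%:R * expR (n.+2%:R : R).
  rewrite -ler_pdivrMl ?ltr0n ?fact_gt0// mulrC.
  by rewrite (le_trans _ (expR_ge1Dxn k (ltW x0)))// lerDr.
rewrite mulrAC ler_pdivlMr ?ltr0n//; apply: (le_trans _ h2).
by rewrite exprSr ler_wpM2l ?exprn_ge0 ?ltW// ltr_nat.
Qed.

Lemma gamma_density_cvg0 (R : realType) (s : R) : 0 < s ->
  gamma_density s n.+2%:R^-1 @[n --> \oo] --> 0.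
Proof.
move=> s0.
have i0 : (n.+2%:R^-1 : R) @[n --> \oo] --> 0.
  by have := @cvg_harmonic R; rewrite -(cvg_shiftS (@harmonic R)).
have /cvg_at_rightP /(_ (fun n => n.+2%:R^-1)) c0 := powR_cvg0 s0.
apply: squeeze_cvgr (cvg_cst 0) (c0 _); last by split=> // n; rewrite invr_gt0 ltr0n.
apply: nearW => n; rewrite gamma_density_ge0 /= /gamma_density ler_piMr ?powR_ge0//.
Qed.

Lemma bigcup_itv_inv_nat (R : realType) :
  \bigcup_n `[(n.+2%:R^-1 : R), n.+2%:R]%classic = `]0, +oo[%classic.
Proof.
apply/seteqP; split=> x /=.
  move=> [n _]; rewrite /= !in_itv /= andbT => /andP[+ _]; apply: lt_le_trans.
  by rewrite invr_gt0 ltr0n.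
rewrite in_itv/= andbT => x0.
pose n := maxn (Num.bound x) (Num.bound x^-1); exists n => //=.
rewrite in_itv/=; apply/andP; split.
  rewrite invf_ple ?posrE ?ltr0n// ltW// (lt_trans (archi_boundP _)) ?invr_ge0 ?ltW//.
  by rewrite ltr_nat ltnW// !ltnS leq_maxr.
rewrite ltW// (lt_trans (archi_boundP (ltW x0)))// ltr_nat.
by rewrite ltnW// !ltnS leq_maxl.
Qed.

Definition gamma_integral (R : realType) (s : R) : \bar R :=
  (\int[lebesgue_measure]_(x in `]0%R, +oo[) (gamma_density s x)%:E)%E.

Lemma gamma_integral_ge0 (R : realType) (s : R) : (0 <= gamma_integral s)%E.
Proof. by apply: integral_ge0 => x _; rewrite lee_fin gamma_density_ge0. Qed.

(** Monotone convergence along compact intervals gives the limit in the extended reals before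
    finiteness is known. The index n + 2 makes the interval nondegenerate already at n = 0. *)
Lemma gamma_integral_cvg (R : realType) (s : R) :
  (\int[lebesgue_measure]_(x in `[n.+2%:R^-1%R, n.+2%:R%R]) (gamma_density s x)%:E)%E
    @[n --> \oo] --> gamma_integral s.
Proof.
rewrite /gamma_integral -bigcup_itv_inv_nat.
apply: ge0_nondecreasing_set_cvg_integral => //.
- apply/nondecreasing_seqP => n; rewrite subsetEset; apply: subset_itv.
    by rewrite bnd_simp lef_pV2 ?posrE ?ltr0n// ler_nat.
  by rewrite bnd_simp ler_nat.
- move=> i; apply/measurable_EFinP. exact: measurable_gamma_density.
- by move=> i x _; rewrite lee_fin gamma_density_ge0.
Qed.

Lemma inv_nat_lt (R : realType) n : n.+2%:R^-1 < n.+2%:R :> R.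
Proof.
by rewrite (@lt_trans _ _ 1)// ?ltr1n// invf_lt1 ?ltr0n// ltr1n.
Qed.

(** Both boundary terms of the integration by parts vanish in the limit, the one at 0 because s + 1
    > 0. The identity holds in the extended reals, so it can serve to prove finiteness. *)
Lemma gamma_integral_rec (R : realType) (s : R) : -1 < s ->
  ((s + 1)%:E * gamma_integral s = gamma_integral (s + 1))%E.
Proof.
move=> s1; have s0 : 0 < s + 1 by rewrite -ltrBlDr sub0r.
have := cvgeZl (isT : (s + 1)%:E \is a fin_num) (@gamma_integral_cvg R s).
under eq_fun do rewrite gamma_density_byparts ?invr_gt0 ?ltr0n ?inv_nat_lt//.
move/cvg_unique; apply; first exact: ereal_hausdorff.
have b0 : ((gamma_density (s + 1) n.+2%:R - gamma_density (s + 1) n.+2%:R^-1)%:E : \bar R)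
    @[n --> \oo] --> 0%:E.
  apply: cvg_EFin; first exact: nearW.
  have := cvgB (@gamma_density_cvgy R (s + 1)) (gamma_density_cvg0 s0); rewrite subr0. apply.
have := cvgeD _ (@gamma_integral_cvg R (s + 1)) b0; rewrite adde0; apply.
by rewrite fin_num_adde_defl.
Qed.

Lemma gamma_integral0_le1 (R : realType) : (gamma_integral (0 : R) <= 1)%E.
Proof.
have := @gamma_integral_cvg R 0 => /cvge_to_le; apply; apply: nearW => n.
(* At s = -1 the factor s + 1 kills the left-hand side, which leaves e^(-a) - e^(-b) for the
   integral of e^(-x) over [a, b]. *)
have := @gamma_density_byparts R (-1) n.+2%:R^-1 n.+2%:R.
rewrite addNr mul0e invr_gt0 ltr0n => /(_ isT (inv_nat_lt R n)) /esym/eqP.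
set J := (\int[_]_(x in _) _)%E; rewrite EFinB.
have : (0 <= J)%E by apply: integral_ge0 => x _; rewrite lee_fin gamma_density_ge0.
case: J => [J||]//; rewrite -EFinB -EFinD lee_fin => J0 /eqP [] JE.
rewrite lee_fin; have := gamma_density_ge0 0 (n.+2%:R : R).
suff : gamma_density 0 (n.+2%:R^-1 : R) <= 1 by lra.
by rewrite /gamma_density powRr0 mul1r -[leRHS]expR0 ler_expR oppr_le0 invr_ge0 ler0n.
Qed.

Lemma gamma_integral_nat_lty (R : realType) (k : nat) : (gamma_integral (k%:R : R) < +oo)%E.
Proof.
elim: k => [|k IH]; first by rewrite (le_lt_trans (gamma_integral0_le1 R))// ltry.
rewrite -natr1 -gamma_integral_rec; last by rewrite (lt_le_trans (ltrN10 R)) ?ler0n.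
by rewrite lte_mul_pinfty// lee_fin addr_ge0.
Qed.

(** The recursion moves the exponent to s + 1 > 0, where x^(s + 1) <= 1 + x^k for an integer k >= s
    + 1; integer exponents are reached by induction. *)
Lemma gamma_integral_lty (R : realType) (s : R) : -1 < s -> (gamma_integral s < +oo)%E.
Proof.
move=> s1; have s0 : 0 < s + 1 by rewrite -ltrBlDr sub0r.
suff : (gamma_integral (s + 1) < +oo)%E.
  rewrite -gamma_integral_rec//; have := gamma_integral_ge0 s.
  by case: (gamma_integral s) => [g||] // _; rewrite ?ltry// gt0_muley ?lte_fin// ltxx.
have [k sk] : exists k : nat, s + 1 <= k%:R.
  by exists (Num.bound (s + 1)); rewrite ltW// archi_boundP// ltW.
apply: (@le_lt_trans _ _ (gamma_integral 0%:R + gamma_integral k%:R)%E); last first.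
  by apply: lte_add_pinfty; exact: gamma_integral_nat_lty.
have mg (t : R) : measurable_fun (`]0, +oo[%classic : set R) (fun x : R => (gamma_density t x)%:E).
  by apply/measurable_EFinP; exact: measurable_gamma_density.
have g0 t x : (0 <= (gamma_density t x)%:E :> \bar R)%E by rewrite lee_fin gamma_density_ge0.
rewrite /gamma_integral -ge0_integralD//; [|exact: mg..].
apply: ge0_le_integral => //; [exact: mg|by apply: emeasurable_funD; exact: mg|].
move=> x /=; rewrite in_itv/= andbT => x0.
rewrite -EFinD lee_fin /gamma_density -mulrDl ler_wpM2r ?expR_ge0//.
have [x1|x1] := leP x 1.
  rewrite (@le_trans _ _ (x `^ 0%:R)) ?lerDl ?powR_ge0//.
  by apply: ger_powR; rewrite ?x0 // ltW.
rewrite (@le_trans _ _ (x `^ k%:R)) ?lerDr ?powR_ge0//.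
by apply: ler_powR => //; exact: ltW.
Qed.

Lemma integrable_gamma_density (R : realType) (s : R) : -1 < s ->
  lebesgue_measure.-integrable (`]0, +oo[%classic : set R) (fun x : R => (gamma_density s x)%:E).
Proof.
move=> s1; apply/integrableP; split.
  by apply/measurable_EFinP; exact: measurable_gamma_density.
under eq_integral do rewrite gee0_abs ?lee_fin ?gamma_density_ge0//.
exact: gamma_integral_lty.
Qed.

(** Strict positivity is what turns a vanishing orthogonality integral into a zero of Q. On [1, 2]
    one has x^s >= 1/x >= 1/2 and e^(-x) >= e^(-2). *)
Lemma gamma_integral_gt0 (R : realType) (s : R) : -1 < s -> (0 < gamma_integral s)%E.
Proof.
move=> s1; apply: (@lt_le_trans _ _ (expR (-2) / 2 : R)%:E).
  by rewrite lte_fin divr_gt0 ?expR_gt0.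
apply: (@le_trans _ _ (\int[lebesgue_measure]_(x in `[1%R, 2%R]) (gamma_density s x)%:E)%E).
  rewrite (_ : (_ / _)%:E = (\int[lebesgue_measure]_(x in `[1%R, 2%R])
      (cst (expR (-2) / 2 : R)%:E x))%E); last first.
    rewrite integral_cst//= lebesgue_measure_itv/= lte_fin ltr1n -EFinB.
    by rewrite (_ : 2 - 1 = 1 :> R) ?mule1//; lra.
  apply: ge0_le_integral => //.
  - by move=> x _; rewrite lee_fin divr_ge0 ?expR_ge0.
  - by apply/measurable_EFinP; exact: measurable_gamma_density.
  move=> x /=; rewrite in_itv/= => /andP[x1 x2]; rewrite lee_fin /gamma_density mulrC.
  apply: ler_pM; rewrite ?invr_ge0 ?expR_ge0//; last by rewrite ler_expR lerN2.
  have h : x `^ (-1) <= x `^ s by apply: ler_powR => //; exact: ltW.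
  apply: le_trans h; rewrite powR_inv1 ?(le_trans _ x1)// lef_pV2 ?posrE//.
  by rewrite (lt_le_trans _ x1).
apply: ge0_subset_integral => //.
- by apply/measurable_EFinP; exact: measurable_gamma_density.
- by move=> x _; rewrite lee_fin gamma_density_ge0.
- by apply: subset_itv; rewrite bnd_simp.
Qed.

(** * Multiple Laguerre polynomials as iterated steps *)

Lemma gamma_integral_rising (R : realType) (s : R) (k : nat) : -1 < s ->
  gamma_integral (s + k%:R) = (((rising R k).[s])%:E * gamma_integral s)%E.
Proof.
move=> s1; elim: k => [|k IH]; first by rewrite addr0 /rising big_ord0 hornerC mul1e.
rewrite -natr1 addrA -gamma_integral_rec ?ltr_wpDr// IH risingS hornerM muleA -EFinM.
by rewrite !hornerE -natr1 addrA mulrC.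
Qed.

Lemma integral_poly_gamma_density (R : realType) (s : R) (p : {poly R}) : -1 < s ->
  (\int[lebesgue_measure]_(x in `]0%R, +oo[) (p.[x] * x `^ s * expR (- x))%:E =
  ((mellin p).[s])%:E * gamma_integral s)%E.
Proof.
move=> s1.
transitivity (\int[lebesgue_measure]_(x in `]0%R, +oo[)
    (\sum_(k < size p) (p`_k)%:E * (gamma_density (s + k%:R) x)%:E))%E.
  apply: eq_integral => x; rewrite inE/= in_itv/= andbT => x0.
  under eq_bigr do rewrite -EFinM.
  rewrite sumEFin; congr (_%:E); rewrite horner_coef !mulr_suml.
  apply: eq_bigr => k _; rewrite /gamma_density.
  have -> : x `^ (s + (nat_of_ord k)%:R) = x `^ s * x ^+ k.
    rewrite powRD; first by rewrite powR_mulrn// ltW.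
    by rewrite (gt_eqF x0) implybT.
  by ring.
have sk (k : nat) : -1 < s + k%:R by rewrite ltr_wpDr.
rewrite integral_sum//=; last first.
  by move=> k; apply: integrableZl => //; exact: integrable_gamma_density.
have gf : gamma_integral s \is a fin_num.
  by rewrite ge0_fin_numE ?gamma_integral_ge0// gamma_integral_lty.
rewrite (@mellinE _ (size p))// horner_sum -(fineK gf) -EFinM mulr_suml -sumEFin.
apply: eq_bigr => k _; rewrite integralZl//; last exact: integrable_gamma_density.
rewrite -/(gamma_integral _) gamma_integral_rising// muleA -EFinM hornerZ.
by rewrite -{1}(fineK gf) -EFinM.
Qed.

Definition nodes (R : realType) (r : nat) (alpha : 'I_r -> R) (n : 'I_r -> nat) :=
  [seq alpha i + k%:R | i <- enum 'I_r, k <- iota 0 (n i)].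

Lemma size_nodes (R : realType) (r : nat) (alpha : 'I_r -> R) (n : 'I_r -> nat) :
  size (nodes alpha n) = mi_size n.
Proof.
rewrite size_allpairs_dep sumnE big_map /mi_size big_enum /=.
by apply: eq_bigr => i _; rewrite size_iota.
Qed.

Lemma prod_nodes (R : realType) (r : nat) (alpha : 'I_r -> R) (n : 'I_r -> nat) :
  \prod_(z <- nodes alpha n) ('X - z%:P) =
  \prod_(i <- enum 'I_r) \prod_(k < n i) ('X - (alpha i + k%:R)%:P).
Proof.
rewrite big_allpairs_dep; apply: eq_bigr => i _.
rewrite -(big_mkord xpredT (fun k : nat => 'X - (alpha i + k%:R)%:P)).
by rewrite /index_iota subn0.
Qed.

(** Orthogonality makes each alpha_i + k with k < n_i a root. Noninteger differences keep these
    points distinct across indices i, and there are |n| of them, which is the degree of the monic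
    Q. *)
Lemma mellin_multLaguerre1 (R : realType) (r : nat) (alpha : 'I_r -> R)
    (n : 'I_r -> nat) (p : {poly R}) :
  (forall i, -1 < alpha i) ->
  (forall i j, i != j -> alpha i - alpha j \isn't a Num.int) ->
  is_multLaguerre1 alpha n p ->
  mellin p = \prod_(z <- nodes alpha n) ('X - z%:P).
Proof.
move=> a1 aZ [pm ps pint]; have [mm ms] := mellin_monic pm.
rewrite [LHS](@all_roots_prod_XsubC _ _ (nodes alpha n)) ?(monicP mm) ?scale1r//.
- by rewrite ms ps size_nodes.
- apply/allP => z /allpairsPdep [i [k [_ ki ->]]].
  rewrite mem_iota add0n /= in ki; rewrite /root.
  have ak : -1 < alpha i + k%:R by rewrite ltr_wpDr.
  have := pint i k ki; rewrite integral_poly_gamma_density// => /eqP.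
  by rewrite mule_eq0 (gt_eqF (gamma_integral_gt0 ak)) orbF eqe.
- rewrite uniq_rootsE; apply: allpairs_uniq_dep.
  + exact: enum_uniq.
  + by move=> i _; exact: iota_uniq.
  move=> [i k] [j l] _ _ /= E.
  have [ij|/aZ/negP[]] := eqVneq i j.
    by move: E; rewrite ij => /addrI/eqP; rewrite eqr_nat => /eqP ->.
  have -> : alpha i - alpha j = l%:R - k%:R by lra.
  by rewrite rpredB ?natr_int.
Qed.

Lemma multLaguerre1_steps (R : realType) (r : nat) (alpha : 'I_r -> R)
    (n : 'I_r -> nat) (p : {poly R}) :
  (forall i, -1 < alpha i) ->
  (forall i j, i != j -> alpha i - alpha j \isn't a Num.int) ->
  is_multLaguerre1 alpha n p ->
  p = foldr (@laguerre_step R) 1 (nodes alpha n).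
Proof.
move=> a1 aZ pL; apply: mellin_inj.
by rewrite (mellin_multLaguerre1 a1 aZ pL) mellin_foldr_step.
Qed.

(** * Location of the zeros *)

Definition rootpoly (F : fieldType) (s : seq F) : {poly F} :=
  \prod_(l <- s) ('X - l%:P).

Definition logder (F : fieldType) (s : seq F) (x : F) : F :=
  \sum_(l <- s) (x - l)^-1.

Lemma rootpoly_cons (F : fieldType) (l : F) s :
  rootpoly (l :: s) = ('X - l%:P) * rootpoly s.
Proof. exact: big_cons. Qed.

Lemma rootpoly_neq0 (F : fieldType) (s : seq F) x :
  x \notin s -> (rootpoly s).[x] != 0.
Proof. by rewrite -[_ != 0]/(~~ root _ _) root_prod_XsubC. Qed.

Lemma deriv_rootpoly (F : fieldType) (s : seq F) x : x \notin s ->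
  (rootpoly s)^`().[x] = (rootpoly s).[x] * logder s x.
Proof.
elim: s => [|l s IH]; first by rewrite /rootpoly /logder !big_nil derivC hornerC mulr0.
rewrite in_cons negb_or => /andP[xl xs].
rewrite rootpoly_cons derivM derivXsubC mul1r hornerD !hornerM IH// /logder big_cons.
by rewrite hornerXsubC; field; rewrite subr_eq0.
Qed.

Lemma deriv2_rootpoly (F : fieldType) (s : seq F) x : x \notin s ->
  (rootpoly s)^`()^`().[x] =
  (rootpoly s).[x] * (logder s x ^+ 2 - \sum_(l <- s) (x - l)^-2).
Proof.
elim: s => [|l s IH].
  by rewrite /rootpoly /logder !big_nil !derivC hornerC expr0n subr0 mulr0.
rewrite in_cons negb_or => /andP[xl xs].
rewrite rootpoly_cons derivM derivXsubC mul1r derivD derivM derivXsubC mul1r.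
rewrite !hornerD !hornerM IH// deriv_rootpoly// /logder !big_cons.
by rewrite hornerXsubC; field; rewrite subr_eq0.
Qed.

Lemma horner_step_rootpoly (F : fieldType) (q : F) (s : seq F) x : x \notin s ->
  (laguerre_step q (rootpoly s)).[x] =
  (rootpoly s).[x] * (x - (1 + q) - x * logder s x).
Proof.
move=> xs; rewrite /laguerre_step !(hornerD, hornerN, hornerM) hornerC hornerX.
by rewrite deriv_rootpoly//; ring.
Qed.

Lemma Re_sum (R : rcfType) (I : Type) (s : seq I) (f : I -> R[i]) :
  complex.Re (\sum_(i <- s) f i) = \sum_(i <- s) complex.Re (f i).
Proof. by apply: (big_ind2 (fun x y => _ x = y)) => // -[a b] _ [c d] _ <- <-. Qed.

Lemma Im_sum (R : rcfType) (I : Type) (s : seq I) (f : I -> R[i]) :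
  complex.Im (\sum_(i <- s) f i) = \sum_(i <- s) complex.Im (f i).
Proof. by apply: (big_ind2 (fun x y => _ x = y)) => // -[a b] _ [c d] _ <- <-. Qed.

(* At a zero [z] outside [s] one has [1 - (1 + q)/z = \sum_l 1/(z - l)]; the two
   sides have imaginary parts of opposite signs unless [z] is real, and real
   parts of opposite signs unless [Re z > 0]. *)
Lemma step_root_pos (R : rcfType) (q : R) (s : seq R) (z : R[i]) :
  0 < 1 + q -> all (fun l => 0 < l) s ->
  root (map_poly (real_complex R) (laguerre_step q (rootpoly s))) z ->
  0 < complex.Re z /\ z = (complex.Re z)%:C.
Proof.
move=> q0 s0.
have -> : map_poly (real_complex R) (laguerre_step q (rootpoly s)) =
    laguerre_step q%:C (rootpoly (map (real_complex R) s)).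
  rewrite /laguerre_step rmorphB !rmorphM /= -deriv_map map_polyXsubC map_polyX.
  by rewrite /rootpoly map_prod_XsubC big_map rmorphD rmorph1.
have [/mapP[l ls ->] _|zs] := boolP (z \in map (real_complex R) s).
  by split=> //=; exact: (allP s0).
rewrite /root horner_step_rootpoly// mulf_eq0 (negPf (rootpoly_neq0 zs)) /=.
rewrite subr_eq0; case: z zs => a b zs.
(* Division by z is about to be used; at z = 0 the equation would read 1 + q = 0. *)
have [ab0|ab0] := eqVneq (a ^+ 2 + b ^+ 2) 0.
  have [-> ->] : a = 0 /\ b = 0.
    move/eqP: ab0; rewrite paddr_eq0 ?sqr_ge0// !sqrf_eq0.
    by move=> /andP[/eqP-> /eqP->].
  rewrite -[0 +i* 0]/(0 : R[i]) sub0r mul0r oppr_eq0 -(rmorph1 (real_complex R)) -rmorphD.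
  by move=> /eqP/complexI q1; rewrite q1 ltxx in q0.
have z0 : a +i* b != 0.
  by apply: contra_neq ab0 => -[-> ->]; rewrite expr0n addr0.
move/eqP/(congr1 (fun w => w / (a +i* b))).
rewrite mulrBl divff// mulrAC divff// mul1r => E.
have ab1 : 0 < a ^+ 2 + b ^+ 2 by rewrite lt_def ab0 addr_ge0 ?sqr_ge0.
rewrite -(rmorph1 (real_complex R)) -rmorphD in E.
have := congr1 (@complex.Im R) E; have := congr1 (@complex.Re R) E.
rewrite /logder big_map Re_sum Im_sum /=.
rewrite !mul0r !subr0 addr0 sub0r => ER EI.
have cd0 : 0 < (1 + q) / (a ^+ 2 + b ^+ 2) by rewrite divr_gt0.
have b0 : b = 0.
  pose S := \sum_(l <- s) ((a - l) ^+ 2 + b ^+ 2)^-1.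
  have S0 : 0 <= S by apply: sumr_ge0 => l _; rewrite invr_ge0 addr_ge0 ?sqr_ge0.
  have : b * ((1 + q) / (a ^+ 2 + b ^+ 2) + S) = 0.
    rewrite mulrDr mulr_sumr; apply/eqP; rewrite addr_eq0 -sumrN -EI; apply/eqP.
    by ring.
  by move/eqP; rewrite mulf_eq0 => /orP[/eqP//|/eqP]; lra.
split; last by rewrite b0.
rewrite ltNge; apply/negP => a0.
have : \sum_(i <- s) (a - i) / ((a - i) ^+ 2 + b ^+ 2) <= 0.
  rewrite big_seq; apply: sumr_le0 => l ls; have l0 := allP s0 _ ls.
  rewrite mulr_le0_ge0 ?invr_ge0 ?addr_ge0 ?sqr_ge0// subr_le0.
  by rewrite (le_trans a0)// ltW.
rewrite -ER mulrA mulrAC; have := mulr_ge0_le0 (ltW cd0) a0; lra.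
Qed.

(** The complex factorization lists the zeros with multiplicity; [step_root_pos] makes them all real
    and positive, so their real parts factor the polynomial over R. The degree rises by exactly one,
    since x h' has at most the degree of h. *)
Lemma laguerre_step_rooted (R : rcfType) (q : R) (s : seq R) :
  0 < 1 + q -> all (fun l => 0 < l) s ->
  exists2 t : seq R, laguerre_step q (rootpoly s) = rootpoly t &
    all (fun l => 0 < l) t /\ size t = (size s).+1.
Proof.
move=> q0 s0; set p := laguerre_step q (rootpoly s).
have sP : size (rootpoly s) = (size s).+1 by exact: size_prod_XsubC.
have Pm : rootpoly s \is monic by exact: monic_prod_XsubC.
pose p1 := ('X - (1 + q)%:P) * rootpoly s.
have sp1 : size p1 = (size s).+2.
  by rewrite size_Mmonic ?polyXsubC_eq0// size_XsubC sP.
have lt : (size (- ('X * (rootpoly s)^`())) < size p1)%N.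
  rewrite sp1 ltnS size_polyN (leq_trans (size_polyMleq _ _))// size_polyX.
  by rewrite (leq_trans (lt_size_deriv _)) ?monic_neq0// sP.
have sp : size p = (size s).+2 by rewrite -sp1 size_polyDl.
have pm : p \is monic.
  by rewrite monicE lead_coefDl// lead_coef_Mmonic// lead_coefXsubC.
have [rs rsE] := closed_field_poly_normal (map_poly (real_complex R) p).
have pCm : lead_coef (map_poly (real_complex R) p) = 1.
  by rewrite lead_coef_map (monicP pm) rmorph1.
rewrite pCm scale1r in rsE.
have rsr z : z \in rs -> 0 < complex.Re z /\ z = (complex.Re z)%:C.
  by move=> zrs; apply: (step_root_pos q0 s0); rewrite -/p rsE root_prod_XsubC.
exists (map (@complex.Re R) rs); last split.
- apply: (map_poly_inj (real_complex R)); rewrite -/p rsE.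
  rewrite /rootpoly map_prod_XsubC big_map big_seq [RHS]big_seq.
  by apply: eq_bigr => z /rsr[_ zE]; rewrite {1}zE.
- by rewrite all_map; apply/allP => z /rsr[].
- apply/succn_inj; rewrite size_map -sp -(size_map_poly (real_complex R)) rsE.
  by rewrite size_prod_XsubC.
Qed.

(* With [psi = \sum_l 1/(x - l)^2], the term [x * psi / D <= 4 * psi] gained by the
   logarithmic derivative is compensated by its decrease from [b] to [b + 4]. *)
Lemma barrier_step (R : realFieldType) (q b : R) (s t : seq R) :
  0 < 1 + q -> 4 * (1 + q) <= b -> all (fun l => l < b) s ->
  logder s b <= 1 / 2 -> laguerre_step q (rootpoly s) = rootpoly t ->
  all (fun l => l < b + 4) t /\ logder t (b + 4) <= logder s b + 4 / b.
Proof.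
move=> q0 qb sb phib st.
have b0 : 0 < b by lra.
have decr x : b <= x -> logder s x <= logder s b.
  move=> bx; rewrite /logder big_seq [leRHS]big_seq; apply: ler_sum => l ls.
  have lb := allP sb _ ls; rewrite /= in lb.
  by rewrite lef_pV2 ?posrE; lra.
have xs x : b <= x -> x \notin s.
  by move=> bx; apply/negP => /(allP sb) /=; lra.
(* The constants 4 and 1/2 of the hypotheses leave x (1 - 1/4 - 1/2). Positivity of this factor
   excludes new zeros beyond b, and the bound x/4 controls the denominator D below. *)
have fac x : b <= x -> x / 4 <= x - (1 + q) - x * logder s x.
  move=> bx; have h := decr x bx.
  have : x * logder s x <= x * (1 / 2) by rewrite ler_wpM2l//; lra.
  lra.
have tx x : b <= x -> x \notin t.
  move=> bx; rewrite -root_prod_XsubC -/(rootpoly t) -st /root.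
  rewrite horner_step_rootpoly ?xs// mulf_eq0 (negPf (rootpoly_neq0 (xs x bx))) /=.
  by apply/eqP => h; have := fac x bx; rewrite h; lra.
split.
  apply/allP => l lt /=; rewrite ltNge; apply/negP => bl.
  by have := tx l; rewrite lt => /(_ _)/negP; case=> //; lra.
set x := b + 4; have bx : b <= x by rewrite /x; lra.
pose psi := \sum_(l <- s) (x - l)^-2.
have psi0 : 0 <= psi.
  by apply: sumr_ge0 => l _; rewrite invr_ge0 sqr_ge0.
have psib : 4 * psi <= logder s b - logder s x.
  rewrite /psi /logder -sumrB mulr_sumr big_seq [leRHS]big_seq.
  apply: ler_sum => l ls; have := allP sb _ ls => /= lb.
  have xl : 0 < x - l by rewrite /x; lra.
  have bl : 0 < b - l by lra.
  rewrite (_ : (b - l)^-1 - (x - l)^-1 = 4 * ((b - l)^-1 * (x - l)^-1)); last first.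
    by rewrite /x; field; rewrite -/x !gt_eqF.
  rewrite ler_pM2l// expr2 invfM ler_wpM2r ?invr_ge0 ?(ltW xl)// lef_pV2 ?posrE//.
  by rewrite /x; lra.
set D := x - (1 + q) - x * logder s x.
have D0 : x / 4 <= D by exact: fac.
have Dp : 0 < D by rewrite /x in D0; lra.
(* The new polynomial is P D near x, with D regarded as a function of x, and the numerator is D'. *)
have phit : logder t x = logder s x + (1 - logder s x + x * psi) / D.
  have P0 := rootpoly_neq0 (xs x bx); have Q0 := rootpoly_neq0 (tx x bx).
  have PE : (rootpoly t).[x] = (rootpoly s).[x] * D.
    by rewrite -st horner_step_rootpoly ?xs.
  apply: (mulfI Q0); rewrite -deriv_rootpoly ?tx// PE -st /laguerre_step.
  rewrite derivB !derivM derivXsubC derivX !mul1r !(hornerD, hornerN, hornerM).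
  rewrite hornerC hornerX deriv2_rootpoly ?xs// deriv_rootpoly ?xs// -/psi.
  by rewrite /D; field; rewrite -/D gt_eqF.
have l0 : 0 <= logder s x.
  rewrite /logder big_seq; apply: sumr_ge0 => l ls.
  by have := allP sb _ ls => /= lb; rewrite invr_ge0 /x; lra.
have x0 : 0 < x by rewrite /x; lra.
have h1 : (1 - logder s x + x * psi) / D <= 4 / x + 4 * psi.
  rewrite ler_pdivrMr//.
  have : (4 / x + 4 * psi) * (x / 4) <= (4 / x + 4 * psi) * D.
    by rewrite ler_wpM2l// addr_ge0 ?mulr_ge0// ?invr_ge0 ltW.
  rewrite (_ : (4 / x + 4 * psi) * (x / 4) = 1 + x * psi); first by lra.
  by field; rewrite gt_eqF.
have h2 : 4 / x <= 4 / b by rewrite ler_pM2l// lef_pV2 ?posrE.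
by rewrite phit; lra.
Qed.

(** After j steps the barrier stands at b + 4 j and the logarithmic derivative there is at most 4
    j/b, starting from 0 for the constant polynomial 1. The assumption 8 j <= b keeps it below the
    threshold 1/2 of [barrier_step]. *)
Lemma steps_roots_bounded (R : rcfType) (qs : seq R) (b : R) :
  0 < b -> (forall q, q \in qs -> 0 < 1 + q /\ 4 * (1 + q) <= b) ->
  8 * (size qs)%:R <= b ->
  exists2 s : seq R, foldr (@laguerre_step R) 1 qs = rootpoly s &
    [/\ size s = size qs, all (fun l => 0 < l) s,
        all (fun l => l < b + 4 * (size qs)%:R) s &
        logder s (b + 4 * (size qs)%:R) <= 4 * (size qs)%:R / b].
Proof.
move=> b0; elim: qs => [|q qs IH] qsb sb.
  by exists [::]; rewrite /rootpoly /logder ?big_nil ?mulr0 ?mul0r.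
have [//||s sE [ss s0 sl sphi]] := IH.
- by move=> q' q'in; apply: qsb; rewrite in_cons q'in orbT.
- by apply: le_trans sb; rewrite ler_pM2l// ler_nat.
have [q0 q4] := qsb q (mem_head _ _).
have [t tE [t0 ts]] := laguerre_step_rooted q0 s0.
have nn : 0 <= (size qs)%:R :> R by exact: ler0n.
have n1 : (size (q :: qs))%:R = (size qs)%:R + 1 :> R by rewrite natr1.
rewrite n1 in sb; rewrite n1 {n1}.
have [||tl tphi] := barrier_step q0 _ sl _ tE.
- by lra.
- by apply: (le_trans sphi); rewrite ler_pdivrMr//; lra.
rewrite mulrDr mulr1 addrA; exists t; first by rewrite /= sE.
split=> //; first by rewrite ts ss.
apply: (le_trans tphi).
rewrite [leRHS]mulrDl; apply: lerD => //.
by rewrite ler_pM2l// lef_pV2 ?posrE//; lra.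
Qed.

(** * Derivatives divided by the polynomial, and the limit of the differential equation *)

(** These are the two leading terms of the binomial expansion; they absorb the contribution of one
    additional zero in the estimates below. *)
Lemma expnS_ge (n l : nat) : (n ^ l.+1 + l.+1 * n ^ l <= n.+1 ^ l.+1)%N.
Proof.
elim: l => [|l IH]; first by rewrite !expn1 expn0 mul1n addn1.
rewrite [leqRHS]expnSr (leq_trans _ (leq_mul IH (leqnn n.+1)))//.
rewrite !(mulnDl, mulnDr, mulnS, expnSr, mulSn); nia.
Qed.

Lemma derivn_XsubCM (R : comNzRingType) (a : R) (q : {poly R}) (l : nat) :
  (('X - a%:P) * q)^`(l.+1) = ('X - a%:P) * q^`(l.+1) + q^`(l) *+ l.+1.
Proof.
elim: l => [|l IH]; first by rewrite derivn1 derivM derivXsubC mul1r addrC.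
rewrite derivnS IH derivD derivM derivXsubC mul1r derivMn -!derivnS.
by rewrite [in RHS]mulrS addrCA addrA.
Qed.

Definition dquot (F : fieldType) (s : seq F) (u : F) (l : nat) : F :=
  (rootpoly s)^`(l).[u] / (rootpoly s).[u].

Lemma dquot0 (F : fieldType) (s : seq F) u : u \notin s -> dquot s u 0 = 1.
Proof. by move=> us; rewrite /dquot derivn0 divff ?rootpoly_neq0. Qed.

Lemma dquot1 (F : fieldType) (s : seq F) u : u \notin s -> dquot s u 1 = logder s u.
Proof.
by move=> us; rewrite /dquot derivn1 deriv_rootpoly// mulrAC divff ?mul1r ?rootpoly_neq0.
Qed.

Lemma dquot_cons (F : fieldType) (a : F) (s : seq F) u l : u \notin a :: s ->
  dquot (a :: s) u l.+1 = dquot s u l.+1 + (u - a)^-1 * dquot s u l *+ l.+1.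
Proof.
rewrite in_cons negb_or => /andP[ua us]; have P0 := rootpoly_neq0 us.
rewrite /dquot rootpoly_cons derivn_XsubCM hornerD !hornerM hornerXsubC hornerMn.
rewrite -mulr_natr -[in RHS]mulr_natr; field.
by rewrite P0 subr_eq0 ua.
Qed.

(** P^(l)/P is the sum, over l-tuples of distinct positions in [s], of the products of the 1/(u -
    a): at most n^l terms, each bounded by W^l. *)
Lemma dquot_bound (F : numFieldType) (W u : F) (s : seq F) (l : nat) :
  u \notin s -> (forall a, a \in s -> `|(u - a)^-1| <= W) ->
  `|dquot s u l| <= (size s)%:R ^+ l * W ^+ l.
Proof.
elim: s l => [|a s IH] l us aW.
  rewrite /dquot /rootpoly big_nil hornerC divr1.
  case: l => [|l]; first by rewrite derivn0 hornerC normr1 !expr0 mulr1.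
  by rewrite derivnC horner0 normr0 expr0n mul0r.
case: l => [|l]; first by rewrite dquot0// normr1 !expr0 mulr1.
have us' : u \notin s by apply: contra us; rewrite in_cons => ->; rewrite orbT.
have aW' b : b \in s -> `|(u - b)^-1| <= W.
  by move=> bs; apply: aW; rewrite in_cons bs orbT.
have W0 : 0 <= W by apply: le_trans (aW a (mem_head _ _)).
rewrite dquot_cons// (le_trans (ler_normD _ _))// normrMn (normrM (u - a)^-1).
apply: (@le_trans _ _ ((size s)%:R ^+ l.+1 * W ^+ l.+1 +
    W * ((size s)%:R ^+ l * W ^+ l) *+ l.+1)).
  apply: lerD; first exact: (IH _ us' aW').
  by rewrite lerMn2r/= ler_pM//; [exact: (aW _ (mem_head _ _))|exact: (IH _ us' aW')].
rewrite (_ : _ + _ = (size s ^ l.+1 + l.+1 * size s ^ l)%:R * W ^+ l.+1); last first.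
  by rewrite natrD natrM !natrX -mulr_natr -natr1 !exprS; ring.
by rewrite -natrX ler_wpM2r ?exprn_ge0// ler_nat expnS_ge.
Qed.

(** In the sum over tuples, the product of the quotients of orders 1 and l also contains the terms
    whose additional position repeats one of the l others. These number at most l n^l, one power of
    n below the main term. *)
Lemma dquot_multiplicative (F : numFieldType) (W u : F) (s : seq F) (l : nat) :
  u \notin s -> (forall a, a \in s -> `|(u - a)^-1| <= W) ->
  `|dquot s u l.+1 - dquot s u 1 * dquot s u l| <=
    l%:R * (size s)%:R ^+ l * W ^+ l.+1.
Proof.
elim: s l => [|a s IH] l us aW.
  rewrite /dquot /rootpoly big_nil derivn1 derivC horner0 !mul0r subr0.
  rewrite hornerC divr1 derivnC/= horner0 normr0.
  case: l => [|l]; first by rewrite !mul0r.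
  by rewrite expr0n mulr0 mul0r.
have us' : u \notin s by apply: contra us; rewrite in_cons => ->; rewrite orbT.
have aW' b : b \in s -> `|(u - b)^-1| <= W.
  by move=> bs; apply: aW; rewrite in_cons bs orbT.
have W0 : 0 <= W by apply: le_trans (aW a (mem_head _ _)).
case: l => [|l]; first by rewrite (dquot0 us) mulr1 subrr normr0 !mul0r.
have wa := aW a (mem_head _ _).
set n := (size s)%:R : F; rewrite !dquot_cons// (dquot0 us').
set w := (u - a)^-1 in wa *.
(* Of the terms created by the new zero, those linear in w recombine into the same defect at order
   l; only the w^2 term is new. *)
rewrite (_ : _ - _ = (dquot s u l.+2 - dquot s u 1 * dquot s u l.+1) +
   (w * (dquot s u l.+1 - dquot s u 1 * dquot s u l) -
    w * w * dquot s u l) *+ l.+1); last first.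
  rewrite -mulr_natr -[in RHS]mulr_natr -[l.+2%:R]natr1; ring.
apply: (@le_trans _ _ (l.+1%:R * n ^+ l.+1 * W ^+ l.+2 +
    (W * (l%:R * n ^+ l * W ^+ l.+1) + W * W * (n ^+ l * W ^+ l)) *+ l.+1)).
  rewrite (le_trans (ler_normD _ _))// lerD ?IH// normrMn lerMn2r/=.
  rewrite (le_trans (ler_normB _ _))// lerD//.
    by rewrite (normrM w) ler_pM// IH.
  by rewrite (normrM (w * w)) (normrM w) !ler_pM// ?mulr_ge0// dquot_bound.
rewrite (_ : _ + _ = l.+1%:R * (size s ^ l.+1 + l.+1 * size s ^ l)%:R * W ^+ l.+2); last first.
  rewrite natrD natrM !natrX -mulr_natr -natr1 /n !exprS; ring.
by rewrite -natrX ler_wpM2r ?exprn_ge0// ler_wpM2l// ler_nat expnS_ge.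
Qed.

Lemma eulerop_is_linear (R : comNzRingType) (e c : R) : linear (eulerop e c).
Proof.
by move=> a g h; rewrite /eulerop derivD derivZ -!mul_polyC; ring.
Qed.

HB.instance Definition _ (R : comNzRingType) (e c : R) :=
  GRing.isLinear.Build R {poly R} {poly R} _ (eulerop e c)
    (@eulerop_is_linear R e c).

Lemma foldr_eulerop_is_linear (R : comNzRingType) (e : R) (cs : seq R) :
  linear (fun h => foldr (eulerop e) h cs).
Proof. by move=> a g h; elim: cs => //= c cs ->; rewrite linearP. Qed.

(** Moving x out through x d/dx costs a shift by one, hence by [e] after scaling. This shift
    disappears in the limit. *)
Lemma eulerop_mulX (R : comNzRingType) (e c : R) (h : {poly R}) :
  eulerop e c ('X * h) = 'X * eulerop e (c + e) h.
Proof. by rewrite /eulerop derivM derivX -!mul_polyC polyCD; ring. Qed.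

Lemma foldr_eulerop_mulX (R : comNzRingType) (e : R) (cs : seq R) (h : {poly R}) :
  foldr (eulerop e) ('X * h) cs =
  'X * foldr (eulerop e) h [seq c + e | c <- cs].
Proof. by elim: cs => //= c cs ->; rewrite eulerop_mulX. Qed.

Lemma eulerop_derivn (R : comNzRingType) (e c : R) (h : {poly R}) l :
  eulerop e c (e ^+ l *: h^`(l)) =
  'X * (e ^+ l.+1 *: h^`(l.+1) - e ^+ l *: h^`(l)) + c *: (e ^+ l *: h^`(l)).
Proof. by rewrite /eulerop derivZ -derivnS -!mul_polyC exprS polyCM; ring. Qed.

Lemma cvg_ext (T : Type) (U : topologicalType) (F : set_system T) (f g : T -> U)
    (l l' : U) : f =1 g -> l = l' -> f @ F --> l -> g @ F --> l'.
Proof. by move=> /funext -> ->. Qed.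

Lemma cvg_dquot (K : numFieldType) (S : nat -> seq K) (e : nat -> K) (u W g : K) :
  0 <= W -> (forall m, e m = (size (S m))%:R^-1) ->
  (forall m, (0 < size (S m))%N) ->
  e @ \oo --> (0 : K) ->
  (forall m, u \notin S m) ->
  (forall m a, a \in S m -> `|(u - a)^-1| <= W) ->
  (fun m => e m * logder (S m) u) @ \oo --> g ->
  forall l, (fun m => e m ^+ l * dquot (S m) u l) @ \oo --> g ^+ l.
Proof.
move=> W0 eE S0 e0 uS uW lg; elim=> [|l IH].
  rewrite (_ : (fun m => _) = cst 1); first exact: cvg_cst.
  by apply/funext => m; rewrite expr0 dquot0// mulr1.
have d0 : (fun m => e m ^+ l.+1 * (dquot (S m) u l.+1 - dquot (S m) u 1 * dquot (S m) u l))
    @ \oo --> (0 : K).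
  have h : (fun m => l%:R * W ^+ l.+1 * e m) @ \oo --> (0 : K).
    by rewrite -[0 as X in _ --> X](mulr0 (l%:R * W ^+ l.+1)); apply: cvgM => //; exact: cvg_cst.
  apply/cvgr0Pnorm_le => eps eps0.
  move/cvgr0Pnorm_le : h => /(_ eps eps0); apply: filterS => m.
  apply: le_trans.
  have em : 0 < e m by rewrite eE invr_gt0 ltr0n.
  rewrite (normrM (e m ^+ _)) [`|_ ^+ _|]ger0_norm ?exprn_ge0 ?(ltW em)//.
  have := dquot_multiplicative l (uS m) (uW m).
  move=> /(ler_wpM2l (exprn_ge0 l.+1 (ltW em)))/le_trans; apply.
  rewrite ger0_norm ?mulr_ge0 ?exprn_ge0 ?(ltW em)// eE.
  have n0 : (size (S m))%:R != 0 :> K by rewrite pnatr_eq0 -lt0n.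
  rewrite [leLHS](_ : _ = l%:R * W ^+ l.+1 / (size (S m))%:R)//.
  rewrite exprVn [in X in X^-1]exprS; have := expf_neq0 l n0.
  by set x := (size (S m))%:R ^+ l; move=> x0; field; rewrite x0 n0.
have c1 : (fun m => e m * dquot (S m) u 1) @ \oo --> g.
  by apply: cvg_ext lg => // m; rewrite dquot1.
apply: cvg_ext (cvgD d0 (cvgM c1 IH)); last by rewrite add0r exprS.
by move=> m; rewrite addrfctE /= exprS; ring.
Qed.

(** In the limit each operator acts as multiplication by u g - u + beta_i, because each scaled
    derivative contributes one factor g. *)
Lemma cvg_foldr_eulerop (K : numFieldType) (S : nat -> seq K) (e : nat -> K)
    (u g : K) (I : Type) (s : seq I) :
  (forall l, (fun m => e m ^+ l * dquot (S m) u l) @ \oo --> g ^+ l) ->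
  e @ \oo --> (0 : K) ->
  forall (l : nat) (b : I -> nat -> K) (beta : I -> K),
  (forall i, b i @ \oo --> beta i) ->
  (fun m => (foldr (eulerop (e m)) (e m ^+ l *: (rootpoly (S m))^`(l))
     [seq b i m | i <- s]).[u] / (rootpoly (S m)).[u]) @ \oo -->
  g ^+ l * \prod_(i <- s) (u * g - u + beta i).
Proof.
(* The innermost operator is removed: it raises the order l of the derivative, and its factor ['X],
   pulled out through the others, shifts their constants by [e]. Hence the induction must range over
   all l and all convergent families b. *)
move=> z e0; elim/last_ind: s => [|s i IH] l b beta bl.
  rewrite big_nil mulr1; apply: cvg_ext (z l) => // m.
  by rewrite /= hornerZ -mulrA.
have be j : (fun m => b j m + e m) @ \oo --> beta j.
  by rewrite -[beta j]addr0; apply: cvgD.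
apply: cvg_ext (cvgD (cvgM (cvg_cst u) (cvgB (IH l.+1 _ _ be) (IH l _ _ be)))
  (cvgM (bl i) (IH l _ _ bl))); last by rewrite big_rcons exprS /=; ring.
move=> m; rewrite addrfctE /= map_rcons foldr_rcons eulerop_derivn.
have lin := @foldr_eulerop_is_linear K (e m).
set h1 := _ *: _^`(l.+1); set h0 := _ *: _^`(l).
rewrite [in X in _ = X](addrC ('X * _)) lin foldr_eulerop_mulX.
have -> : h1 - h0 = (-1) *: h0 + h1 by rewrite scaleN1r addrC.
rewrite lin -map_comp !(hornerD, hornerZ, hornerM) hornerX /h1 derivnS /comp.
by rewrite !addrfctE !opprfctE /=; ring.
Qed.

(** * Topology and integration on the complex plane *)

Lemma continuous_complex_lipschitz (R : realType) (f : R[i]^o -> R) :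
  (forall x y : R[i], (`|f x - f y|)%:C <= `|x - y|) -> continuous f.
Proof.
move=> lf x; apply/(@cvgrPdist_lt _ _ _ _ (nbhs_filter (x : R[i]^o)) f (f x)) => e e0.
apply/nbhs_ballP; exists e%:C; first by rewrite /= ltcR.
by move=> y; rewrite -ball_normE /= => h; rewrite -ltcR; exact: le_lt_trans h.
Qed.

Lemma ler_normc_Re (R : realType) (x : R[i]) : (`|complex.Re x|)%:C <= `|x|.
Proof. exact: normc_ge_Re. Qed.

Lemma ler_normc_Im (R : realType) (x : R[i]) : (`|complex.Im x|)%:C <= `|x|.
Proof.
case: x => a b; rewrite normc_def lecR /= -sqrtr_sqr ler_sqrt ?addr_ge0 ?sqr_ge0//.
by rewrite lerDr sqr_ge0.
Qed.

Lemma continuous_Re (R : realType) : continuous (@complex.Re R : R[i]^o -> R).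
Proof.
apply: continuous_complex_lipschitz => -[a b] [c d].
exact: (ler_normc_Re ((a +i* b) - (c +i* d))).
Qed.

Lemma continuous_Im (R : realType) : continuous (@complex.Im R : R[i]^o -> R).
Proof.
apply: continuous_complex_lipschitz => -[a b] [c d].
exact: (ler_normc_Im ((a +i* b) - (c +i* d))).
Qed.

Lemma normc_le_ReIm (R : realType) (x : R[i]) :
  `|x| <= (`|complex.Re x| + `|complex.Im x|)%:C.
Proof.
case: x => a b; rewrite normc_def lecR /=.
rewrite -[leRHS]ger0_norm ?addr_ge0// -sqrtr_sqr ler_sqrt ?sqr_ge0//.
rewrite sqrrD !real_normK ?num_real// -addrA lerD2l lerDr mulrn_wge0// mulr_ge0//.
Qed.

Lemma cvg_complex (R : realType) (T : Type) (F : set_system T) (FF : Filter F)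
    (f g : T -> R) (a b : R) : f @ F --> a -> g @ F --> b ->
  (fun t => (f t +i* g t : R[i]^o)) @ F --> (a +i* b : R[i]^o).
Proof.
move=> fa gb; apply/cvgrPdist_lt => e e0.
have [e' e'0 ->] : exists2 e', 0 < e' & e = e'%:C.
  case: e e0 => x y; rewrite ltcE /= => /andP[/eqP -> x0]; by exists x.
have h0 : 0 < e' / 2 by rewrite divr_gt0.
move/cvgrPdist_lt : fa => /(_ _ h0) fa; move/cvgrPdist_lt : gb => /(_ _ h0) gb.
near=> t.
apply: (le_lt_trans (normc_le_ReIm _)); rewrite ltcR /=.
have h1 : `|a - f t| < e' / 2 by near: t.
have h2 : `|b - g t| < e' / 2 by near: t.
by rewrite [ltRHS](splitr e') ltrD.
Unshelve. all: by end_near. Qed.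

Lemma continuous_sqr2 (R : realType) (T : topologicalType) (a b : T -> R) :
  continuous a -> continuous b -> continuous (fun z => a z ^+ 2 + b z ^+ 2).
Proof.
move=> ca cb z; apply: cvgD; rewrite expr2; apply: cvgM;
  by [exact: ca|exact: cb].
Qed.

Lemma compact_cball_complex (R : realType) (M : R) :
  compact [set z : R[i]^o | complex.Re z ^+ 2 + complex.Im z ^+ 2 <= M ^+ 2].
Proof.
pose h (x : R * R) : R[i]^o := x.1 +i* x.2.
pose B := `[- `|M|, `|M|]%classic : set R.
have ch : continuous h.
  move=> x; apply: cvg_complex; [exact: cvg_fst|exact: cvg_snd].
have cB : compact (h @` (B `*` B)).
  apply: continuous_compact; first exact: continuous_subspaceT.
  by apply: compact_setX; exact: segment_compact.
have cN := continuous_sqr2 (@continuous_Re R) (@continuous_Im R).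
apply: subclosed_compact cB _.
  exact: (closed_comp (fun z _ => cN z) (@closed_le R (M ^+ 2))).
move=> [a b] /= ab; exists (a, b) => //; rewrite /B; split; rewrite /= in_itv/= -ler_norml.
  by rewrite -(@ler_pXn2r _ 2)// ?nnegrE// !real_normK ?num_real// (le_trans _ ab)// lerDl sqr_ge0.
by rewrite -(@ler_pXn2r _ 2)// ?nnegrE// !real_normK ?num_real// (le_trans _ ab)// lerDr sqr_ge0.
Qed.

Lemma continuous_measurable_complexB (R : realType) (f : R[i]^o -> R) :
  continuous f -> measurable_fun [set: complexB R] (f : complexB R -> R).
Proof.
move=> cf; apply: (measurability _ (RGenOpens.measurableE R)).
move=> _ [_ [a [b ->]] <-]; rewrite setTI.
apply: sub_sigma_algebra; rewrite /=.
by apply: open_comp; [move=> z _; exact: cf|exact: interval_open].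
Qed.

Lemma integral_zero_counting_ge0 (R : realType) (p : {poly R})
    (f : complexB R -> R) :
  measurable_fun setT f -> (forall z, 0 <= f z) ->
  (\int[zero_counting_measure p]_z (f z)%:E =
  ((size (zeros p))%:R^-1 * \sum_(z <- zeros p) f z)%:E)%E.
Proof.
move=> mf f0; have mfE : measurable_fun setT (EFin \o f) by exact/measurable_EFinP.
rewrite /zero_counting_measure ge0_integral_mscale//; last first.
  by move=> z _; rewrite lee_fin.
rewrite ge0_integral_measure_sum//; last by move=> z _; rewrite lee_fin.
rewrite EFinM; congr (_ * _)%E.
under eq_bigr do rewrite integral_dirac// diracT mul1e.
by rewrite sumEFin (big_nth 0) big_mkord.
Qed.

Lemma Rintegral_zero_counting (R : realType) (p : {poly R}) (f : complexB R -> R) :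
  measurable_fun setT f ->
  \int[zero_counting_measure p]_z f z =
  (size (zeros p))%:R^-1 * \sum_(z <- zeros p) f z.
Proof.
move=> mf; rewrite /Rintegral integralE.
have -> : (fun z => (f z)%:E)^\+%E = (fun z => (Num.max (f z) 0)%:E).
  by apply/funext => z; rewrite funeposE EFin_max.
have -> : (fun z => (f z)%:E)^\-%E = (fun z => (Num.max (- f z) 0)%:E).
  by apply/funext => z; rewrite funenegE EFin_max.
rewrite !integral_zero_counting_ge0; last 4 first.
- by apply: measurable_maxr => //; exact: measurable_funN.
- by move=> z; rewrite le_max lexx orbT.
- by apply: measurable_maxr.
- by move=> z; rewrite le_max lexx orbT.
rewrite -EFinB /= -mulrBr -sumrB; congr (_ * _); apply: eq_bigr => z _.
case: (leP (f z) 0); case: (leP (- f z) 0); lra.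
Qed.

Lemma compact_closure_support (R : realType) (c : R) (f : R[i]^o -> R) :
  (forall z : R[i], f z != 0 -> complex.Re z ^+ 2 + complex.Im z ^+ 2 <= c) ->
  compact (closure [set z | f z != 0]).
Proof.
move=> fc; have cN := continuous_sqr2 (@continuous_Re R) (@continuous_Im R).
(* Since c <= (1 + |c|)^2, the bound on the squared modulus becomes a radius, whatever the sign of
   c. *)
have cl := closed_comp (fun z _ => cN z) (@closed_le R ((1 + `|c|) ^+ 2)).
have cc := @compact_cball_complex R (1 + `|c|).
apply: (subclosed_compact _ cc); first exact: closed_closure.
rewrite closureE => z; apply; split; first exact: cl.
move=> y /fc /le_trans; apply.
rewrite sqrrD expr1n mul1r; have := ler_norm c; have := sqr_ge0 `|c|; have := normr_ge0 c.
rewrite mulr2n; lra.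
Qed.

Lemma normc_gt (R : realType) (K : R) (z : R[i]) : 0 <= K ->
  (K%:C < `|z|) = (K ^+ 2 < complex.Re z ^+ 2 + complex.Im z ^+ 2).
Proof.
move=> K0; rewrite -(@ltr_pXn2r _ 2 isT K%:C)// ?nnegrE ?ler0c//.
by rewrite -add_Re2_Im2 -rmorphXn ltcR.
Qed.

Lemma continuous_bump (R : realType) (T : topologicalType) (a b : T -> R) (s t : R) :
  continuous a -> continuous b -> continuous (fun z : T =>
    Num.max 0 (Num.min (a z ^+ 2 + b z ^+ 2 - s) (t - (a z ^+ 2 + b z ^+ 2)))).
Proof.
move=> ca cb z; have c2 := continuous_sqr2 ca cb.
apply: (@continuous_max _ _ (cst 0) _ z); first exact: cvg_cst.
apply: continuous_min; apply: cvgB; by [exact: c2|exact: cvg_cst].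
Qed.

(** Flooring the denominator at d > 0 removes the pole of the Cauchy kernel and changes nothing
    where the squared distance to the pole is at least d. *)
Lemma continuous_cutoff_kernel (R : realType) (T : topologicalType) (a b h : T -> R)
    (d : R) : 0 < d -> continuous a -> continuous b -> continuous h ->
  continuous (fun z : T => h z / Num.max d (a z ^+ 2 + b z ^+ 2)).
Proof.
move=> d0 ca cb ch z; apply: cvgM; first exact: ch.
apply: cvgV; first by rewrite gt_eqF// lt_max d0.
apply: (@continuous_max _ _ (cst d) _ z); first exact: cvg_cst.
exact: (continuous_sqr2 ca cb).
Qed.

(** * Limits of zero-counting measures *)

(** The test functions h_j are positive exactly on the annuli K^2 < |z|^2 < K^2 + j + 1, the outer
    radius making their supports compact. Their integrals against the counting measures are
    eventually 0, and the annuli exhaust the exterior of the disc. *)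
Lemma weak_star_limit_support (R : realType) (p : nat -> {poly R})
    (mu : {finite_measure set (complexB R) -> \bar R}) (K : R) : 0 <= K ->
  weak_star_cvg (fun m => zero_counting_measure (p m)) mu ->
  (\forall m \near \oo, forall z, z \in zeros (p m) -> `|z| <= K%:C) ->
  mu [set v : complexB R | K%:C < `|v : R[i]|] = 0%E.
Proof.
move=> K0 wc zK.
pose h j (z : R[i]^o) := Num.max 0 (Num.min
  (complex.Re z ^+ 2 + complex.Im z ^+ 2 - K ^+ 2)
  (K ^+ 2 + j.+1%:R - (complex.Re z ^+ 2 + complex.Im z ^+ 2))) : R.
have ch j : continuous (h j).
  exact: (continuous_bump (@continuous_Re R) (@continuous_Im R)).
have mh j : measurable_fun [set: complexB R] (h j : complexB R -> R).
  exact: continuous_measurable_complexB.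
have h0 j z : 0 <= h j z by rewrite /h le_max lexx.
have hK j (z : R[i]) : `|z| <= K%:C -> h j z = 0.
  move=> /le_gtF; rewrite normc_gt// => /negbT; rewrite -leNgt => zK2.
  by apply/max_idPl; rewrite ge_min subr_le0 zK2.
have ih j : (\int[mu]_z (h j z)%:E = 0)%E.
  have cpt : compact (closure [set z : R[i]^o | h j z != 0]).
    apply: (@compact_closure_support _ (K ^+ 2 + j.+1%:R)) => z.
    apply: contraNT; rewrite -ltNge => zj; rewrite /h.
    by apply/eqP/max_idPl; rewrite ge_min; apply/orP; right; rewrite subr_le0 ltW.
  have := wc (h j) (ch j) cpt.
  have c0 : (fun m => \int[zero_counting_measure (p m)]_z h j z) @ \oo --> (0 : R).
    apply: cvg_near_cst; apply: filterS zK => m zK.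
    by rewrite Rintegral_zero_counting// big_seq big1 ?mulr0// => z /zK /hK.
  move/(cvg_unique (@Rhausdorff R) c0) => /esym.
  (* The real-valued integral is 0 by default when the integral is infinite; integrability makes its
     vanishing meaningful. *)
  have ij : mu.-integrable setT (EFin \o h j).
    apply: (@le_integrable _ _ _ mu setT measurableT _ (EFin \o cst (j.+1%:R : R))).
    - exact/measurable_EFinP.
    - move=> z _ /=; rewrite lee_fin !ger0_norm//.
      rewrite ge_max ler0n /= ge_min; apply/orP.
      have [|] := leP (complex.Re z ^+ 2 + complex.Im z ^+ 2 - K ^+ 2) j.+1%:R.
        by left.
      by right; have := ler0n R j.+1; lra.
    - exact: finite_measure_integrable_cst.
  by rewrite /Rintegral => /eqP; rewrite fine_eq0 ?integrable_fin_num// => /eqP.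
have mA : measurable [set v : complexB R | K%:C < `|v : R[i]|].
  rewrite (_ : [set _ | _] = (fun z : complexB R => complex.Re (z : R[i]^o) ^+ 2 +
      complex.Im (z : R[i]^o) ^+ 2) @^-1` `]K ^+ 2, +oo[%classic).
    rewrite -[_ @^-1` _]setTI; apply: continuous_measurable_complexB => //.
    exact: (continuous_sqr2 (@continuous_Re R) (@continuous_Im R)).
  by apply/seteqP; split=> z /=; rewrite in_itv/= andbT normc_gt.
apply/(negligibleP _ mA).
have : mu.-negligible (\bigcup_j [set z : complexB R | h j z != 0]).
  apply: negligible_bigcup => j.
  have /(ae_eq_integral_abs _ measurableT) :
      measurable_fun setT (EFin \o h j : complexB R -> \bar R).
    exact/measurable_EFinP.
  move=> /(_ mu) [+ _].
  under eq_integral do rewrite /= ger0_norm//.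
  move=> /(_ (ih j)) [N [mN N0 hN]]; exists N; split=> // z hz; apply: hN => /= /(_ I) [] /eqP.
  exact/negP.
apply: negligibleS => z /=; rewrite normc_gt// => Kz.
exists (Num.bound (complex.Re z ^+ 2 + complex.Im z ^+ 2)) => //=.
rewrite gt_eqF// /h lt_max; apply/orP; right; rewrite lt_min subr_gt0 Kz/= subr_gt0.
have n0 : 0 <= complex.Re z ^+ 2 + complex.Im z ^+ 2 by rewrite addr_ge0 ?sqr_ge0.
have := archi_boundP n0; rewrite -natr1; have := sqr_ge0 K; lra.
Qed.

(** The kernel is a pointwise limit of continuous ones, with floors 1/(m + 1). At a pole h = 0 makes
    every approximation vanish, in agreement with the convention for division by 0. *)
Lemma measurable_kernel (R : realType) (a b h : R[i]^o -> R) :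
  continuous a -> continuous b -> continuous h ->
  (forall z, a z ^+ 2 + b z ^+ 2 = 0 -> h z = 0) ->
  measurable_fun [set: complexB R] (fun z : complexB R => h z / (a z ^+ 2 + b z ^+ 2)).
Proof.
move=> ca cb ch h0.
apply: (@measurable_fun_cvg _ (complexB R) R setT
  (fun m (z : complexB R) => h z / Num.max m.+1%:R^-1 (a z ^+ 2 + b z ^+ 2))).
  move=> m; have i0 : 0 < m.+1%:R^-1 :> R by rewrite invr_gt0.
  exact: (continuous_measurable_complexB (continuous_cutoff_kernel i0 ca cb ch)).
move=> z _; have [n0|n0] := eqVneq (a z ^+ 2 + b z ^+ 2) 0.
  by rewrite h0// mul0r; under eq_fun do rewrite mul0r; exact: cvg_cst.
apply: cvgM; first exact: cvg_cst.
have np : 0 < a z ^+ 2 + b z ^+ 2 by rewrite lt_def n0 addr_ge0 ?sqr_ge0.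
apply: cvgV => //; apply: cvg_near_cst.
have /cvgr0_norm_le := @cvg_harmonic R; move=> /(_ _ np); apply: filterS => m.
by rewrite ger0_norm /= => [hm|]; [apply/max_idPr|rewrite invr_ge0].
Qed.

(** The numerators Re(u - z) and -Im(u - z) give the real and imaginary parts of 1/(u - z). The
    kernel is replaced by a continuous compactly supported function equal to it on |z| <= K, a disc
    that eventually contains all zeros and whose complement is mu-null. *)
Lemma weak_star_kernel (R : realType) (p : nat -> {poly R})
    (mu : {finite_measure set (complexB R) -> \bar R}) (K : R) (u : R[i])
    (h : R[i]^o -> R) : 0 <= K ->
  weak_star_cvg (fun m => zero_counting_measure (p m)) mu ->
  (\forall m \near \oo, forall z, z \in zeros (p m) -> `|z| <= K%:C) ->
  K%:C < `|u| -> continuous h -> h u = 0 ->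
  let k (z : complexB R) : R := h z / ((complex.Re u - complex.Re (z : R[i])) ^+ 2
    + (complex.Im u - complex.Im (z : R[i])) ^+ 2) in
  (fun m => (size (zeros (p m)))%:R^-1 * \sum_(z <- zeros (p m)) k z) @ \oo -->
  \int[mu]_z k z.
Proof.
move=> K0 wc zK uK ch hu k.
pose nu := Num.sqrt (complex.Re u ^+ 2 + complex.Im u ^+ 2).
have nuE : `|u| = nu%:C by rewrite normc_def.
have Knu : K < nu by rewrite -ltcR -nuE.
pose n2 (z : R[i]^o) := complex.Re z ^+ 2 + complex.Im z ^+ 2.
have cn2 : continuous n2 := continuous_sqr2 (@continuous_Re R) (@continuous_Im R).
pose chi (z : R[i]^o) : R := Num.max 0 (Num.min 1 (K ^+ 2 + 1 - n2 z)).
(* For |z| <= K one has |u - z| >= |u| - K = nu - K, so the floor is inactive on the disc. *)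
pose f (z : R[i]^o) : R := (chi z * h z) / Num.max ((nu - K) ^+ 2)
  ((complex.Re u - complex.Re z) ^+ 2 + (complex.Im u - complex.Im z) ^+ 2).
have cB (T : topologicalType) (g : T -> R) (c : R) : continuous g -> continuous (fun z => c - g z).
  by move=> cg z; apply: cvgB; [exact: cvg_cst|exact: cg].
have cchi (T : topologicalType) (g : T -> R) (c : R) : continuous g ->
    continuous (fun z => Num.max 0 (Num.min 1 (c - g z))).
  move=> cg z; apply: (@continuous_max _ _ (cst 0) _ z); first exact: cvg_cst.
  by apply: (@continuous_min _ _ (cst 1) _ z); [exact: cvg_cst|exact: cB].
have cM (T : topologicalType) (g1 g2 : T -> R) : continuous g1 -> continuous g2 ->
    continuous (fun z => g1 z * g2 z).
  by move=> c1 c2 z; apply: cvgM; [exact: c1|exact: c2].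
have cRe := cB _ _ (complex.Re u) (@continuous_Re R).
have cIm := cB _ _ (complex.Im u) (@continuous_Im R).
have cf : continuous f.
  apply: continuous_cutoff_kernel => //; first by rewrite exprn_gt0// subr_gt0.
  by apply: cM => //; exact: cchi.
have fk (z : R[i]) : ~~ (K%:C < `|z|) -> f z = k z.
  rewrite normc_gt// -leNgt => zK2.
  have c1 : chi z = 1.
    rewrite /chi; have -> : Num.min 1 (K ^+ 2 + 1 - n2 z) = 1.
      by apply/min_idPl; rewrite /n2; lra.
    by apply/max_idPr.
  rewrite /f c1 mul1r /k; congr (_ / _); apply/max_idPr.
  have zn : `|z| <= K%:C.
    rewrite normc_def lecR -(@ger0_norm _ K)// -sqrtr_sqr.
    by rewrite ler_sqrt ?sqr_ge0.
  have : (nu - K)%:C <= `|u - z|.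
    rewrite rmorphB /= -nuE; apply: le_trans (lerB_dist _ _); exact: lerB.
  case: (u) (z) => [u1 u2] [z1 z2]; rewrite normc_def lecR /= => h1.
  have nK : 0 <= nu - K by rewrite subr_ge0 ltW.
  by rewrite -ler_sqrt ?addr_ge0 ?sqr_ge0// sqrtr_sqr ger0_norm.
have cpt : compact (closure [set z : R[i]^o | f z != 0]).
  apply: (@compact_closure_support _ (K ^+ 2 + 1)) => z.
  apply: contraNT; rewrite -ltNge => zj; rewrite /f.
  suff -> : chi z = 0 by rewrite !mul0r.
  by apply/max_idPl; rewrite ge_min; apply/orP; right; rewrite subr_le0 ltW.
have mf : measurable_fun [set: complexB R] (f : complexB R -> R).
  exact: continuous_measurable_complexB.
have mk : measurable_fun [set: complexB R] k.
  apply: (@measurable_kernel _ (fun z => complex.Re u - complex.Re z)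
    (fun z => complex.Im u - complex.Im z)) => // z /eqP.
  rewrite paddr_eq0 ?sqr_ge0// !sqrf_eq0 !subr_eq0 => /andP[/eqP e1 /eqP e2].
  rewrite -hu; congr h; apply/eqP; rewrite eq_complex; apply/andP; split; exact/eqP.
have := wc f cf cpt.
have -> : \int[mu]_z f z = \int[mu]_z k z.
  rewrite /Rintegral; congr fine; apply: ae_eq_integral => //.
  - exact/measurable_EFinP.
  - exact/measurable_EFinP.
  have mu0 := weak_star_limit_support K0 wc zK.
  exists [set v : complexB R | K%:C < `|v : R[i]|]; split=> //.
    rewrite (_ : [set _ | _] = (n2 : complexB R -> R) @^-1` `]K ^+ 2, +oo[%classic).
      by rewrite -[_ @^-1` _]setTI; apply: continuous_measurable_complexB.
    by apply/seteqP; split=> z /=; rewrite in_itv/= andbT normc_gt.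
  move=> z /= zfk; apply/negPn/negP => hz; apply: zfk => _.
  by rewrite (fk _ hz).
apply: cvg_trans; apply: near_eq_cvg; apply: filterS zK => m zK.
rewrite Rintegral_zero_counting//; congr (_ * _).
rewrite big_seq [RHS]big_seq; apply: eq_bigr => z /zK zk.
by apply: fk; rewrite (le_gtF zk).
Qed.

Lemma cvg_logder_cauchy (R : realType) (p : nat -> {poly R})
    (mu : {finite_measure set (complexB R) -> \bar R}) (K : R) (u : R[i]) : 0 <= K ->
  weak_star_cvg (fun m => zero_counting_measure (p m)) mu ->
  (\forall m \near \oo, forall z, z \in zeros (p m) -> `|z| <= K%:C) ->
  K%:C < `|u| ->
  (fun m => ((size (zeros (p m)))%:R^-1 * logder (zeros (p m)) u : R[i]^o)) @ \oo -->
  (cauchy_transform mu u : R[i]^o).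
Proof.
move=> K0 wc zK uK.
have cR : continuous (fun z : R[i]^o => complex.Re u - complex.Re z : R).
  have gen (T : topologicalType) (g : T -> R) (c : R) :
      continuous g -> continuous (fun z => c - g z).
    by move=> cg z; apply: cvgB; [exact: cvg_cst|exact: cg].
  exact: gen (@continuous_Re R).
have cI : continuous (fun z : R[i]^o => - (complex.Im u - complex.Im z) : R).
  have gen (T : topologicalType) (g : T -> R) (c : R) :
      continuous g -> continuous (fun z => - (c - g z)).
    by move=> cg z; apply: cvgN; apply: cvgB; [exact: cvg_cst|exact: cg].
  exact: gen (@continuous_Im R).
have hR := weak_star_kernel K0 wc zK uK cR (subrr _).
have hI := weak_star_kernel K0 wc zK uK cI _.
have {hI} hI := hI (etrans (congr1 -%R (subrr _)) (oppr0 _)).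
rewrite /= in hR hI.
refine (@cvg_ext _ (R[i]^o) _ _ _ _ _ _ _ (cvg_complex _ hR hI)).
  move=> m; rewrite -(rmorph_nat (real_complex R)) -fmorphV /logder.
  set x := (_%:R)^-1; set S := \sum_(l <- _) (u - l)^-1.
  have -> : \sum_(z <- zeros (p m)) (complex.Re u - complex.Re z) /
      ((complex.Re u - complex.Re z) ^+ 2 + (complex.Im u - complex.Im z) ^+ 2) = complex.Re S.
    by rewrite Re_sum; apply: eq_bigr => -[z1 z2] _; case: (u).
  have -> : \sum_(z <- zeros (p m)) - (complex.Im u - complex.Im z) /
      ((complex.Re u - complex.Re z) ^+ 2 + (complex.Im u - complex.Im z) ^+ 2) = complex.Im S.
    by rewrite Im_sum; apply: eq_bigr => -[z1 z2] _; case: (u) => u1 u2 /=; rewrite mulNr.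
  by case: S => s1 s2; apply/eqP; rewrite eq_complex /= !mul0r subr0 addr0 !eqxx.
rewrite /cauchy_transform; congr (_ +i* _); apply: eq_Rintegral => -[z1 z2] _;
  case: (u) => u1 u2 //=.
by rewrite mulNr.
Qed.

(** * The algebraic equation *)

Lemma nodes_bounds (R : realType) (r : nat) (alpha : 'I_r -> R)
    (n : 'I_r -> nat) (B q : R) :
  (forall i, -1 < alpha i) -> (forall i, alpha i + (n i)%:R <= B) ->
  q \in nodes alpha n -> 0 < 1 + q /\ 1 + q <= B.
Proof.
move=> a1 aB /allpairsPdep[i [k [_ ki ->]]].
rewrite mem_iota add0n /= in ki.
have := a1 i; have := aB i; have := ler0n R k.
have : k.+1%:R <= (n i)%:R :> R by rewrite ler_nat.
by rewrite -natr1; lra.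
Qed.

Lemma zerosE (R : realType) (p : {poly R}) :
  map_poly (real_complex R) p =
  lead_coef (map_poly (real_complex R) p) *: rootpoly (zeros p).
Proof. by rewrite /zeros; case: closed_field_poly_normal. Qed.

Lemma size_zeros (R : realType) (p : {poly R}) : p != 0 ->
  size (zeros p) = (size p).-1.
Proof.
move=> p0; rewrite -(size_map_poly (real_complex R)) zerosE size_scale.
  by rewrite size_prod_XsubC.
by rewrite lead_coef_map (fmorph_eq0 (real_complex R)) lead_coef_eq0.
Qed.

Lemma mem_zeros (R : realType) (p : {poly R}) z :
  z \in zeros p -> root (map_poly (real_complex R) p) z.
Proof.
by move=> zp; rewrite zerosE rootE hornerZ (rootP _) ?mulr0// root_prod_XsubC.
Qed.

(** The barrier starts at b = 8 c N, which dominates both 4 (1 + q) <= 4 c N and 8 N. It advances by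
    4 in each of the N steps, and division by N leaves 8 c + 4. *)
Lemma multLaguerre1_zeros_le (R : realType) (r : nat) (alpha : 'I_r -> R)
    (n : 'I_r -> nat) (p : {poly R}) (c : R) :
  (forall i, -1 < alpha i) ->
  (forall i j, i != j -> alpha i - alpha j \isn't a Num.int) ->
  is_multLaguerre1 alpha n p ->
  (0 < mi_size n)%N -> 1 <= c ->
  (forall i, alpha i + (n i)%:R <= c * (mi_size n)%:R) ->
  forall z, z \in zeros (p \Po ((mi_size n)%:R *: 'X)) -> `|z| <= (8 * c + 4)%:C.
Proof.
move=> a1 aZ pL N0 c1 aB z.
set N := (mi_size n)%:R : R; have NN : 0 < N by rewrite ltr0n.
have cN : N <= c * N by rewrite ler_peMl// ltW.
have h1 : 0 < 8 * c * N by rewrite -mulrA mulr_gt0// mulr_gt0// (lt_le_trans ltr01).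
have h2 q : q \in nodes alpha n -> 0 < 1 + q /\ 4 * (1 + q) <= 8 * c * N.
  by move=> /(nodes_bounds a1 aB)[q0 qB]; split=> //; rewrite -/N in qB; lra.
have h3 : 8 * (size (nodes alpha n))%:R <= 8 * c * N.
  by rewrite size_nodes -/N; lra.
have [s sE [_ s0 sN _]] := steps_roots_bounded h1 h2 h3.
rewrite -(multLaguerre1_steps a1 aZ pL) in sE; rewrite size_nodes -/N in sN.
move=> /mem_zeros.
rewrite map_comp_poly map_polyZ map_polyX /root horner_comp hornerZ hornerX.
rewrite sE /rootpoly map_prod_XsubC => zr.
have : N%:C * z \in map (real_complex R) s.
  by rewrite -root_prod_XsubC big_map.
move=> /mapP[l ls zl].
have l0 := allP s0 _ ls; have lN := allP sN _ ls; rewrite /= in l0 lN.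
have -> : z = (l / N)%:C.
  have NC : N%:C != 0 by rewrite (fmorph_eq0 (real_complex R)) gt_eqF.
  by apply: (mulfI NC); rewrite zl -rmorphM /=; congr (_%:C); field; rewrite gt_eqF.
rewrite normc_def /= expr0n addr0 sqrtr_sqr lecR ger0_norm ?divr_ge0 ?(ltW l0) ?(ltW NN)//.
by rewrite ler_pdivrMr// ltW// (lt_le_trans lN)//; lra.
Qed.

Lemma map_foldr_eulerop (R S : comNzRingType) (f : {rmorphism R -> S}) (e : R)
    (cs : seq R) (h : {poly R}) :
  map_poly f (foldr (eulerop e) h cs) =
  foldr (eulerop (f e)) (map_poly f h) (map f cs).
Proof.
elim: cs => //= c cs <-.
rewrite /eulerop rmorphD rmorphB /= !map_polyZ !rmorphM /= map_polyX.
by rewrite deriv_map.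
Qed.

Lemma cvg_real_complex (R : realType) (f : nat -> R) (a : R) :
  f @ \oo --> a -> (fun m => (f m)%:C : R[i]^o) @ \oo --> (a%:C : R[i]^o).
Proof. by move=> fa; exact: (cvg_complex _ fa (cvg_cst 0)). Qed.

Lemma foldr_eulerop_scale (R : comNzRingType) (e : R) (cs : seq R) c (h : {poly R}) :
  foldr (eulerop e) (c *: h) cs = c *: foldr (eulerop e) h cs.
Proof. by elim: cs => //= k cs ->; rewrite linearZ. Qed.

Lemma cvg_affine_eq0 (K : numFieldType) (u x y : K) (f g : nat -> K) :
  f @ \oo --> x -> g @ \oo --> y -> (forall m, u * f m + g m = 0) ->
  u * x + y = 0.
Proof.
move=> fx gy fg.
have h : (fun m => u * f m + g m) @ \oo --> u * x + y.
  by apply: cvgD => //; apply: cvgM => //; exact: cvg_cst.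
apply: (cvg_unique (@norm_hausdorff _ _) h).
by rewrite (_ : (fun m => _) = cst 0); [exact: cvg_cst|apply/funext].
Qed.

Lemma limit_algebraic_equation (R : realType) (r : nat)
    (n : nat -> 'I_r -> nat) (alpha : nat -> 'I_r -> R)
    (A theta : 'I_r -> R) (L : nat -> {poly R}) (K : R) (u g : R[i]) :
  let N m := mi_size (n m) in
  let P m := L m \Po ((N m)%:R *: 'X) in
  (forall m, (0 < N m)%N) ->
  (fun m => (N m)%:R^-1 : R) @ \oo --> (0 : R) ->
  (forall m i, -1 < alpha m i) ->
  (forall m i j, i != j -> alpha m i - alpha m j \isn't a Num.int) ->
  (forall m, is_multLaguerre1 (alpha m) (n m) (L m)) ->
  (forall i, (fun m => alpha m i / (N m)%:R) @ \oo --> A i) ->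
  (forall i, (fun m => (n m i)%:R / (N m)%:R) @ \oo --> theta i) ->
  (forall m z, z \in zeros (P m) -> `|z| <= K%:C) -> K%:C < `|u| ->
  (fun m => ((size (zeros (P m)))%:R^-1 * logder (zeros (P m)) u : R[i]^o)) @ \oo -->
    (g : R[i]^o) ->
  u * \prod_(i < r) (u * g + (A i)%:C + (theta i)%:C - u)
  = (u - u * g) * \prod_(i < r) (u * g + (A i)%:C - u).
Proof.
move=> N P N0 Ninf a1 aZ LE alim nlim zK uK glim.
have NR m : (N m)%:R != 0 :> R by rewrite pnatr_eq0 -lt0n.
pose S m := zeros (P m).
have L0 m : L m != 0 by case: (LE m) => /monic_neq0.
have sP m : size (P m) = (N m).+1.
  rewrite size_comp_poly2 ?size_scale ?size_polyX//.
  by case: (LE m) => _ ->.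
have P0 m : P m != 0 by rewrite -size_poly_eq0 sP.
have sS m : size (S m) = N m by rewrite size_zeros// sP.
pose e m : R[i] := (size (S m))%:R^-1.
have eE m : e m = ((N m)%:R^-1)%:C by rewrite /e sS fmorphV /= rmorph_nat.
have e0 : (e : nat -> R[i]^o) @ \oo --> (0 : R[i]^o).
  by refine (@cvg_ext _ (R[i]^o) _ _ _ _ _ _ _ (cvg_real_complex Ninf)).
have uS m : u \notin S m.
  by apply/negP => /zK /(lt_le_trans uK); rewrite ltxx.
pose W : R[i] := (`|u| - K%:C)^-1.
have W0 : 0 <= W by rewrite invr_ge0 subr_ge0 ltW.
have uW m z : z \in S m -> `|(u - z)^-1| <= W.
  move=> /zK zk; rewrite normfV lef_pV2 ?posrE ?subr_gt0//.
    by apply: le_trans (lerB_dist _ _); exact: lerB.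
  rewrite normr_gt0 subr_eq0; apply/eqP => uz.
  by have := lt_le_trans uK; rewrite uz => /(_ _ zk); rewrite ltxx.
have S0 m : (0 < size (S m))%N by rewrite sS.
have zl := @cvg_dquot R[i] S e u W g W0 (fun m => erefl) S0 e0 uS uW glim.
pose b (i : 'I_r) m : R[i] := ((N m)%:R^-1 * (1 + alpha m i + (n m i)%:R))%:C.
(* [None] stands for the additional operator with constant 0; its limit factor u g - u becomes u - y
   on the right-hand side. *)
pose a (o : option 'I_r) m : R[i] :=
  if o is Some i then ((N m)%:R^-1 * alpha m i)%:C else 0.
have bl i : (b i : nat -> R[i]^o) @ \oo --> ((A i + theta i)%:C : R[i]^o).
  apply: cvg_real_complex.
  apply: cvg_ext (cvgD Ninf (cvgD (alim i) (nlim i))) => [m|]; last by rewrite add0r.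
  by rewrite !addrfctE; field.
have al o : (a o : nat -> R[i]^o) @ \oo -->
    ((if o is Some i then (A i)%:C else 0) : R[i]^o).
  case: o => [i|]; last exact: cvg_cst.
  apply: cvg_real_complex; apply: cvg_ext (alim i) => // m.
  by rewrite mulrC.
pose T m cs := foldr (eulerop (e m)) (rootpoly (S m)) cs.
have ode m : 'X * T m [seq b i m | i <- enum 'I_r] +
    T m [seq a o m | o <- None :: [seq Some i | i <- enum 'I_r]] = 0.
  have c0 : lead_coef (map_poly (real_complex R) (P m)) != 0.
    by rewrite lead_coef_map (fmorph_eq0 (real_complex R)) lead_coef_eq0.
  have zE := zerosE (P m); move: c0 zE; set c := lead_coef _ => c0 zE.
  have NRV : (N m)%:R^-1 != 0 :> R by rewrite invr_eq0.
  have mL := mellin_multLaguerre1 (a1 m) (aZ m) (LE m).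
  rewrite prod_nodes in mL.
  have := laguerre_ode_rescaled NRV mL; rewrite /= invrK -/(P m).
  rewrite -[eulerop _ 0 _]/(foldr (eulerop _) _ (0 :: _)).
  move=> /(congr1 (map_poly (real_complex R))).
  rewrite rmorph0 rmorphD rmorphM /= map_polyX.
  rewrite -[eulerop _ 0 _]/(foldr (eulerop _) (P m) (0 :: _)).
  rewrite !map_foldr_eulerop -!map_comp zE -/(S m) /= -eE.
  rewrite !foldr_eulerop_scale linearZ /= -scalerAr -scalerDr => /eqP.
  rewrite scaler_eq0 (negPf c0) /= => /eqP.
  by rewrite /T /= -!map_comp.
have h1 := @cvg_foldr_eulerop R[i] S e u g _ (enum 'I_r) zl e0 0 b _ bl.
have h2 := @cvg_foldr_eulerop R[i] S e u g _ (None :: [seq Some i | i <- enum 'I_r]) zl e0 0 a _ al.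
have := @cvg_affine_eq0 R[i] u _ _ _ _ h1 h2.
rewrite !expr0 !mul1r big_cons big_map !big_enum /= addr0 => lim.
have {lim}/eqP : u * \prod_(i < r) (u * g - u + (A i + theta i)%:C) +
    (u * g - u) * \prod_(i < r) (u * g - u + (A i)%:C) = 0.
  apply: lim => m; have /(congr1 (fun h => h.[u])) := ode m.
  rewrite hornerD hornerM hornerX horner0 !scale1r /T /=.
  by rewrite mulrA -mulrDl => ->; rewrite mul0r.
rewrite addr_eq0 -mulNr opprB => /eqP.
have -> : \prod_(i < r) (u * g - u + (A i + theta i)%:C) =
    \prod_(i < r) (u * g + (A i)%:C + (theta i)%:C - u).
  by apply: eq_bigr => i _; rewrite rmorphD /=; ring.
have -> : \prod_(i < r) (u * g - u + (A i)%:C) = \prod_(i < r) (u * g + (A i)%:C - u).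
  by apply: eq_bigr => i _; ring.
by [].
Qed.

(** The neighborhood of infinity is the exterior |u| > K. As mu does not charge that exterior, 1/(u
    - v) is bounded mu-almost everywhere for such u, so the integrals in the Cauchy transform are
    genuine and not default values. *)
Theorem theorem5p8 (R : realType) (r : nat)
    (n : nat -> 'I_r -> nat) (alpha : nat -> 'I_r -> R)
    (A theta : 'I_r -> R) (L : nat -> {poly R})
    (mu : {finite_measure set (complexB R) -> \bar R})
    (n_gt0 : forall m i, (0 < n m i)%N)
    (n_infty : (fun m => mi_size (n m)) @ \oo --> \oo)
    (alpha_gt : forall m i, -1 < alpha m i)
    (alpha_nint : forall m i j, i != j -> alpha m i - alpha m j \isn't a Num.int)
    (alpha_lim : forall i,
       (fun m => alpha m i / (mi_size (n m))%:R) @ \oo --> A i)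
    (A_ge0 : forall i, 0 <= A i)
    (n_lim : forall i,
       (fun m => (n m i)%:R / (mi_size (n m))%:R) @ \oo --> theta i)
    (theta_gt0 : forall i, 0 < theta i)
    (L_def : forall m, is_multLaguerre1 (alpha m) (n m) (L m))
    (mu_lim : limiting_zero_distribution
       (fun m => L m \Po ((mi_size (n m))%:R *: 'X)) mu) :
  exists K : R, mu [set v : complexB R | K%:C < `|v : R[i]|] = 0%E /\
    forall u : R[i], K%:C < `|u| ->
      let y := u * cauchy_transform mu u in
      u * \prod_(i < r) (y + (A i)%:C + (theta i)%:C - u)
      = (u - y) * \prod_(i < r) (y + (A i)%:C - u).
Proof.
pose N m := mi_size (n m).
(* Eventually alpha_i/N <= A_i + 1, and n_i <= N adds another 1; the sum dominates every A_i at
   once. *)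
pose c := \sum_i (A i) + 2; pose K := 8 * c + 4.
have A0 : 0 <= \sum_i A i by exact: sumr_ge0.
have c1 : 1 <= c by rewrite /c; lra.
have K0 : 0 <= K by rewrite /K; lra.
have ev : \forall m \near \oo, (0 < N m)%N /\
    forall i, alpha m i + (n m i)%:R <= c * (N m)%:R.
  have ev1 : \forall m \near \oo, (0 < N m)%N.
    by have /cvgnyPgt := n_infty; apply.
  have ev2 : \forall m \near \oo, forall i, alpha m i / (N m)%:R <= A i + 1.
    apply: filter_forall => i.
    have /cvgrPdist_le /(_ 1 ltr01) := alpha_lim i.
    by apply: filterS => m; rewrite ler_norml; rewrite -/(N m); lra.
  apply: filterS2 ev1 ev2 => m N0 h; split=> // i.
  have NR : 0 < (N m)%:R :> R by rewrite ltr0n.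
  have := h i; rewrite ler_pdivrMr// => h1.
  have nN : (n m i)%:R <= (N m)%:R :> R.
    by rewrite ler_nat /N /mi_size (bigD1 i)//= leq_addr.
  have Ai : A i <= \sum_i A i.
    by rewrite (bigD1 i)//= lerDl sumr_ge0.
  have : (A i + 2) * (N m)%:R <= c * (N m)%:R by rewrite ler_wpM2r ?ler0n// lerD2r.
  lra.
have [m0 _ hm0] := ev.
have [phi [phi_mono wc]] := mu_lim.
have phi_ge m : (m <= phi m)%N.
  elim: m => // m IH; exact: leq_ltn_trans IH (phi_mono _ _ (ltnSn m)).
(* Dropping the first m0 terms of the subsequence makes the eventual bounds hold for every index
   without changing the limit. *)
pose psi m := phi (m + m0)%N.
have psi_ge m : (m <= psi m)%N by rewrite (leq_trans _ (phi_ge _))// leq_addr.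
have psi_infty : psi @ \oo --> \oo.
  apply/cvgnyPge => M; exists M => // m /= Mm; exact: leq_trans Mm (psi_ge m).
have good m := hm0 (psi m) (leq_trans (leq_addl m m0) (phi_ge _)).
pose P m := L (psi m) \Po ((N (psi m))%:R *: 'X).
have wcP : weak_star_cvg (fun m => zero_counting_measure (P m)) mu.
  move=> f cf cpt; have := wc f cf cpt.
  by rewrite -(cvg_shiftn m0).
have zK m z : z \in zeros (P m) -> `|z| <= K%:C.
  have [N0 hB] := good m.
  exact: (multLaguerre1_zeros_le (alpha_gt _) (alpha_nint _) (L_def _) N0 c1 hB).
have zKn : \forall m \near \oo, forall z, z \in zeros (P m) -> `|z| <= K%:C.
  by apply: nearW => m z; exact: zK.
exists K; split; first exact: (weak_star_limit_support K0 wcP zKn).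
move=> u uK /=.
have Ninf : (fun m => (N (psi m))%:R^-1 : R) @ \oo --> (0 : R).
  have inv0 : (fun k : nat => k%:R^-1 : R) @ \oo --> (0 : R).
    by rewrite -cvg_shiftS; exact: cvg_harmonic.
  have h : (fun m => N (psi m)) @ \oo --> \oo := cvg_comp _ _ psi_infty n_infty.
  exact: (cvg_comp _ _ h inv0).
apply: (@limit_algebraic_equation R r (n \o psi) (alpha \o psi) A theta (L \o psi) K) => //.
- by move=> m; have [] := good m.
- by move=> m i; exact: alpha_gt.
- by move=> m i j; exact: alpha_nint.
- by move=> m; exact: L_def.
- by move=> i; exact: cvg_comp psi_infty (alpha_lim i).
- by move=> i; exact: cvg_comp psi_infty (n_lim i).
- exact: (cvg_logder_cauchy K0 wcP zKn uK).
Qed.
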